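(* Let $(\xi_l)_{l\ge0}$ be a subordinator with Laplace–Bernstein exponent $\Phi\not\equiv0$, let $\mathcal I=\int_0^\infty e^{-\xi_l}\mathrm dl$, $I(r)=\mathbb E[\mathcal I^{r-1}]$, and let $\kappa$ be the measure on $\mathbb R_+$ whose Laplace transform is $\Phi'/\Phi$. Then for all $r>0$, \[ I(r)=\Gamma(r)\,\Phi(1)^{-r+1}\exp\Bigl[-\int_{(0,+\infty)}\frac{e^{-(r-1)x}-1-(r-1)(e^{-x}-1)}{x\,(e^x-1)}\,\kappa(\mathrm dx)\Bigr]. \]
   Context: $\Phi$ is defined by $\mathbb E[e^{-s\xi_l}]=e^{-l\Phi(s)}$ for $l,s\ge0$; $\kappa$ is the measure on $[0,\infty)$ with $\int e^{-sx}\kappa(\mathrm dx)=\Phi'(s)/\Phi(s)$ for $s>0$. $\Gamma$ is Euler's Gamma function. *)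

(* Defs.v *)
From HB Require Import structures.
From mathcomp Require Import all_boot all_order all_algebra.
From mathcomp Require Import all_classical all_reals all_analysis measurable_realfun lebesgue_integral.
Set Implicit Arguments. Unset Strict Implicit. Unset Printing Implicit Defensive.
Import Order.TTheory GRing.Theory Num.Theory.
Import numFieldNormedType.Exports.
Local Open Scope classical_set_scope.
Local Open Scope ring_scope.

(* A (possibly killed) subordinator, following Bertoin's definition:
   a process indexed by l >= 0 with values in [0, +oo] (+oo = cemetery),
   xi_0 = 0, nondecreasing right-continuous paths, and for all t, s >= 0,
   conditionally on {xi_t < +oo}, the increment xi_{t+s} - xi_t is independent
   of (xi_v, v <= t) and has the same law as xi_s.  The conditional
   independence is stated on finite-dimensional cylinders of (xi_v, v <= t). *)
Definition subordinator d (T : measurableType d) (R : realType)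
    (P : probability T R) (xi : R -> T -> \bar R) : Prop :=
  [/\ (forall t : R, 0 <= t -> measurable_fun [set: T] (xi t)),
      (forall w, xi 0 w = 0%E),
      (forall w (s t : R), 0 <= s -> s <= t -> (xi s w <= xi t w)%E),
      (forall w (t : R), 0 <= t -> (fun l => xi l w) @ t^'+ --> xi t w) &
      (forall t s : R, 0 <= t -> 0 <= s ->
        forall (n : nat) (v : 'I_n -> R) (Bs : 'I_n -> set (\bar R)) (B : set (\bar R)),
        (forall i, 0 <= v i <= t) -> (forall i, measurable (Bs i)) -> measurable B ->
        P [set w | (xi t w < +oo)%E /\ B (xi (t + s)%R w - xi t w)%E /\
                   forall i, Bs i (xi (v i) w)]
        = (P [set w | (xi t w < +oo)%E /\ forall i, Bs i (xi (v i) w)]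
           * P [set w | B (xi s w)])%E)].

(* Exponential functional  I = \int_0^oo exp(-xi_l) dl  (exp(-oo... ) = 0 after killing). *)
Definition expfun d (T : measurableType d) (R : realType) (xi : R -> T -> \bar R)
    (w : T) : \bar R :=
  (\int[@lebesgue_measure R]_(l in `[0%R, +oo[) expeR (- xi l w))%E.

Definition Gammaf (R : realType) (r : R) : \bar R :=
  (\int[@lebesgue_measure R]_(t in `]0%R, +oo[) (t `^ (r - 1) * expR (- t))%:E)%E.

Definition kint (R : realType) (r x : R) : R :=
  (expR (- ((r - 1) * x)) - 1 - (r - 1) * (expR (- x) - 1)) / (x * (expR x - 1)).

(* Main.v *)
Require Import Defs.
From HB Require Import structures.
From mathcomp Require Import all_boot all_order all_algebra.
From mathcomp Require Import all_classical all_reals all_analysis measurable_realfun lebesgue_integral.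
From mathcomp Require Import ring lra.
Import Order.TTheory GRing.Theory Num.Theory.
Import numFieldNormedType.Exports.
Local Open Scope classical_set_scope.
Local Open Scope ring_scope.
Set Implicit Arguments.
Unset Strict Implicit.

(** Write X_l = exp(-xi_l).  The proof compares three functions of r > 0:
    m(r) = E[I^(r-1)], Gamma(r), and F(r) = Phi(1)^(r-1) exp(int kint_r dkappa).

    Recursion for m.  Fix a mesh h and let D = h sum_(k >= 1) X_(kh), so that
    D <= I <= D + h.  Splitting off the first increment of the random walk
    (xi_(kh))_k shows that D has the law of e^(-xi_h) (D' + h) with D' a copy of D
    independent of xi_h, whence
    E[(D+h)^p] - E[D^p] = (e^(h Phi(p)) - 1) E[D^p].  Dividing by h and letting h -> 0
    gives p E[I^(p-1)] = Phi(p) E[I^p], that is r m(r) = Phi(r) m(r+1).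

    Recursion for F.  Since kappa has Laplace transform (ln Phi)',
    ln Phi(r) - ln Phi(1) = int (e^(-x) - e^(-rx))/x kappa(dx), which is exactly
    int (kint_(r+1) - kint_r) dkappa, so F(r+1) = Phi(r) F(r).

    Hence m F / Gamma is 1-periodic with value 1 at r = 1.  Both m and Gamma are
    log-convex, which pins down m(n+1+w)/m(n+1) and Gamma(n+1+w)/Gamma(n+1) up to a
    factor tending to 1; F(n+1+w)/F(n+1) is Phi(n+1)^w exp(int e^(-nx) kint_(1+w) dkappa),
    with an exponent tending to 0.  So the periodic function is constantly 1. *)

(** * Real powers *)

(** The definition of a subordinator makes only the last increment independent of the past, whereas
    the identity in law for D needs the first one split off. The transition operator of the chain
    (accumulated sum, current factor) reconciles the two: conditioning on the past produces one
    application of the operator, the chain starts at the deterministic point (0, 1), and the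
    outermost operator in an iterate evaluated there is the first increment. Killing is absorbed by
    e^(-oo) = 0 and by restricting P to the survival event.

    For p < 1 the difference quotients are dominated only by I^(p-1), whose integrability is itself
    in question; Fatou's lemma supplies it.

    On the analytic side, Cauchy-Schwarz gives Phi(2s) <= 2 Phi(s), and this doubling bound serves
    in place of concavity: it yields the positivity of Phi, the decay of Phi'/Phi, and through that
    decay the absence of an atom of kappa at 0. The formula for ln Phi comes from the monotonicity
    of Phi'/Phi by subdividing intervals, without Fubini. *)

Section powR_lemmas.
Context {R : realType}.
Implicit Types x y p : R.

Lemma powR_continuous_gt0 p x : 0 < x -> {for x, continuous (fun t => t `^ p)}.
Proof.
move=> x0; apply: differentiable_continuous; apply/derivable1_diffP.
by have [] := is_derive1_powR p x0.
Qed.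

Lemma powR_MVT p x y : 0 < x -> x < y ->
  exists2 c, x < c < y & y `^ p - x `^ p = p * c `^ (p - 1) * (y - x).
Proof.
move=> x0 xy.
have [z zxy||c cxy E] := @MVT R (fun t => t `^ p) (fun t => p * t `^ (p - 1)) x y xy.
- by apply: is_derive1_powR; move: zxy; rewrite in_itv/= => /andP[xz _]; exact: lt_trans xz.
- apply: continuous_in_subspaceT => z; rewrite inE/= in_itv/= => /andP[xz _].
  by apply: powR_continuous_gt0; exact: lt_le_trans xz.
- exists c => //; move: cxy; rewrite in_itv.
Qed.

Lemma ler_powR_npos p x y : p <= 0 -> 0 < x -> x <= y -> y `^ p <= x `^ p.
Proof.
move=> p0 x0 xy; have y0 := lt_le_trans x0 xy.
rewrite -[p]opprK !(powRN _ (- p)) lef_pV2 ?posrE ?powR_gt0//.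
by rewrite ge0_ler_powR ?oppr_ge0// nnegrE ltW.
Qed.

(** Mean value theorem with a nondecreasing derivative; x = 0 is treated directly. Dominates the
    difference quotients of D^p when p >= 1. *)
Lemma powR_diff_le_ge1 p x h : 1 <= p -> 0 <= x -> 0 < h ->
  (x + h) `^ p - x `^ p <= p * h * (x + h) `^ (p - 1).
Proof.
move=> p1 x0 h0.
have p0 : 0 < p by apply: lt_le_trans p1.
have [x00|xp] := eqVneq x 0.
  rewrite x00 add0r powR0 ?gt_eqF// subr0 -mulr_powRB1//; last exact: ltW.
  by rewrite -mulrA ler_peMl// mulr_ge0 ?powR_ge0// ltW.
have {}x0 : 0 < x by rewrite lt_def xp.
have [|c /andP[xc cy] ->] := @powR_MVT p x (x + h) x0; first by rewrite ltrDl.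
rewrite addrAC subrr add0r mulrAC ler_wpM2l ?mulr_ge0 ?(ltW p0) ?(ltW h0)//. 
have c0 := lt_trans x0 xc.
by rewrite ge0_ler_powR ?subr_ge0 ?nnegrE ?(ltW c0) ?(ltW cy)// addr_ge0 ?(ltW x0) ?(ltW h0).
Qed.

(** Write (x + h)^p = x (x + h)^(p-1) + h (x + h)^(p-1) and use that t^(p-1) is nonincreasing. The
    factor (x + h)^(p-1), rather than x^(p-1), is the one that compares with I^(p-1), since I <= D +
    h. *)
Lemma powR_diff_le_le1 p x h : 0 < p -> p <= 1 -> 0 <= x -> 0 < h ->
  (x + h) `^ p - x `^ p <= h * (x + h) `^ (p - 1).
Proof.
move=> p0 p1 x0 h0.
have xh0 : 0 < x + h by rewrite ltr_wpDl.
rewrite -mulr_powRB1 ?(ltW xh0)// mulrDl lerBlDr addrC lerD2l.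
rewrite -(mulr_powRB1 x0)//.
have [->|xp] := eqVneq x 0; first by rewrite !mul0r.
have {}x0 : 0 < x by rewrite lt_def xp.
rewrite ler_pM2l// ler_powR_npos// ?subr_le0//.
by rewrite lerDl ltW.
Qed.

Lemma powR_diff_ge0 p x h : 0 <= p -> 0 <= x -> 0 < h -> 0 <= (x + h) `^ p - x `^ p.
Proof.
move=> p0 x0 h0; rewrite subr_ge0 ge0_ler_powR ?nnegrE ?lerDl ?addr_ge0// ltW//.
Qed.

(** The base point moves with the step, so this is more than the derivative at x: the mean value
    point is squeezed between [u n] and [u n + h n], which both tend to x. *)
Lemma powR_diff_cvg p (x : R) (u h : R^nat) : 0 < x ->
  (forall n, 0 < h n) -> u @ \oo --> x -> h @ \oo --> 0 ->
  (fun n => ((u n + h n) `^ p - u n `^ p) / h n) @ \oo --> p * x `^ (p - 1).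
Proof.
move=> x0 h0 ux hx.
have cx : {for x, continuous (fun t => p * t `^ (p - 1))}.
  by apply: continuousM; [exact: cvg_cst|exact: powR_continuous_gt0].
apply/cvgrPdist_lt => e e0.
have /cvgrPdist_lt/(_ e e0) /nbhs_ballP[d /= d0 dP] := cx.
have uhx : (fun n => u n + h n) @ \oo --> x by rewrite -[x]addr0; exact: cvgD.
near=> n.
have un0 : 0 < u n.
  by near: n; apply: (cvgr_gt x).
have [|c /andP[uc cu] ->] := @powR_MVT p (u n) (u n + h n) un0; first by rewrite ltrDl.
rewrite addrAC subrr add0r mulfK ?gt_eqF//.
apply: dP; rewrite /ball/= ltr_distlC.
apply/andP; split.
  apply: lt_trans uc; near: n; apply: (cvgr_gt x) => //; lra.
apply: (lt_trans cu); near: n; apply: (cvgr_lt x) => //; lra.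
Unshelve. all: by end_near. Qed.

(** Continuity when x > 0; when x = 0 the bounds force [u] to vanish identically. *)
Lemma powR_cvg_nneg p (x : R) (u : R^nat) : 0 < p -> (forall n, 0 <= u n <= x) ->
  u @ \oo --> x -> (fun n => u n `^ p) @ \oo --> x `^ p.
Proof.
move=> p0 ux cu.
have x0 : 0 <= x by case/andP: (ux 0) => ? /(le_trans _); exact.
have [x00|xp] := eqVneq x 0.
  rewrite (_ : (fun n => _) = cst (x `^ p)); first exact: cvg_cst.
  apply/funext => n /=; congr (_ `^ _); apply/eqP; rewrite eq_le.
  by have /andP[u0 ->] := ux n; rewrite x00.
have {}x0 : 0 < x by rewrite lt_def xp.
have cx := powR_continuous_gt0 (p := p) x0.
have := (@continuous_cvg _ _ _ _ _ u (fun t => t `^ p) x cx cu).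
by apply.
Qed.

Lemma powRD_le p x y : 0 <= p -> 0 <= x -> 0 <= y ->
  (x + y) `^ p <= 2 `^ p * (x `^ p + y `^ p).
Proof.
move=> p0 x0 y0.
wlog xy : x y x0 y0 / x <= y.
  move=> H; have [xy|/ltW yx] := leP x y; first exact: H.
  by rewrite addrC [in leRHS]addrC; exact: H.
apply: (@le_trans _ _ (2 `^ p * y `^ p)).
  rewrite -powRM// ge0_ler_powR ?nnegrE ?addr_ge0 ?mulr_ge0//; lra.
by rewrite ler_wpM2l ?powR_ge0// lerDr powR_ge0.
Qed.

(** The coefficient b may be as close to 1 as desired, which later lets a contraction factor
    survive. With e^p = b, one has 1 + x <= e x as soon as x >= 1/(e - 1); below this threshold the
    left side is bounded by the constant c. *)
Lemma powR_addl_split p (b : R) : 0 < p -> 1 < b -> exists c : R, 0 <= c /\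
  forall x, 0 <= x -> (1 + x) `^ p <= b * x `^ p + c.
Proof.
move=> p0 b1.
pose e := b `^ p^-1.
have b0 : 0 <= b by rewrite ltW// (lt_trans ltr01).
have e1 : 1 < e.
  have -> : 1 = 1 `^ p^-1 :> R by rewrite powR1.
  by rewrite gt0_ltr_powR ?invr_gt0 ?nnegrE.
exists ((1 + (e - 1)^-1) `^ p); split; first exact: powR_ge0.
move=> x x0.
have e0 : 0 < e - 1 by rewrite subr_gt0.
have [xe|/ltW xe] := leP (e - 1)^-1 x.
  have : 1 + x <= e * x.
    have : (e - 1)^-1 * (e - 1) <= x * (e - 1) by rewrite ler_pM2r.
    rewrite mulVf ?gt_eqF//; lra.
  move=> H; apply: (@le_trans _ _ (b * x `^ p)); last by rewrite lerDl powR_ge0.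
  have -> : b = e `^ p by rewrite /e -powRrM mulVf ?gt_eqF// powRr1.
  rewrite -powRM//; last by lra.
  rewrite ge0_ler_powR ?nnegrE ?(ltW p0)//; nra.
apply: (@le_trans _ _ ((1 + (e - 1)^-1) `^ p)).
  by rewrite ge0_ler_powR ?nnegrE ?(ltW p0) ?addr_ge0 ?invr_ge0 ?(ltW e0)// lerD2l.
by rewrite lerDr mulr_ge0 ?powR_ge0.
Qed.
End powR_lemmas.

(** * Log-convexity *)

Section log_convexity.
Context {d : measure_display} {T : measurableType d} {R : realType}
  (mu : {measure set T -> \bar R}) (D : set T) (mD : measurable D).

Lemma powR_young (x y t : R) : 0 <= x -> 0 <= y -> 0 < t < 1 ->
  x `^ (1 - t) * y `^ t <= (1 - t) * x + t * y.
Proof.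
move=> x0 y0 /andP[t0 t1].
have t10 : 0 < 1 - t by rewrite subr_gt0.
have := @conjugate_powR _ (x `^ (1 - t)) (y `^ t) (1 - t)^-1 t^-1
  (powR_ge0 _ _) (powR_ge0 _ _).
rewrite !invr_gt0 !invrK -!powRrM !mulfV ?gt_eqF// !powRr1//.
by rewrite subrK [x * _]mulrC [y * _]mulrC; apply.
Qed.

(** Hoelder's inequality, by integrating the weighted arithmetic-geometric inequality for the
    normalised functions u/U and v/V. The majorant [g] has integral c, and it also gives the
    integrability of the geometric mean. *)
Lemma Rintegral_log_convex (u v : T -> R) (t : R) : 0 < t < 1 ->
  (forall x, D x -> 0 <= u x) -> (forall x, D x -> 0 <= v x) ->
  mu.-integrable D (EFin \o u) -> mu.-integrable D (EFin \o v) ->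
  0 < \int[mu]_(x in D) u x -> 0 < \int[mu]_(x in D) v x ->
  mu.-integrable D (EFin \o (fun x => u x `^ (1 - t) * v x `^ t)) /\
  \int[mu]_(x in D) (u x `^ (1 - t) * v x `^ t)
    <= (\int[mu]_(x in D) u x) `^ (1 - t) * (\int[mu]_(x in D) v x) `^ t.
Proof.
move=> t01 u0 v0 iu iv; set U := \int[mu]_(x in D) u x; set V := \int[mu]_(x in D) v x.
move=> U0 V0.
pose c := U `^ (1 - t) * V `^ t.
have c0 : 0 < c by rewrite mulr_gt0 ?powR_gt0.
pose g x := c * (1 - t) / U * u x + c * t / V * v x.
have ug x : D x -> u x `^ (1 - t) * v x `^ t <= g x.
  move=> Dx; have := powR_young (x := u x / U) (y := v x / V) _ _ t01.
  rewrite !divr_ge0 ?u0 ?v0 ?(ltW U0) ?(ltW V0)// => /(_ isT isT).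
  rewrite !powRM ?invr_ge0 ?u0 ?v0 ?(ltW U0) ?(ltW V0)//.
  rewrite -(ler_pM2l c0) => H.
  have <- : c * (u x `^ (1 - t) * U^-1 `^ (1 - t) * (v x `^ t * V^-1 `^ t)) =
      u x `^ (1 - t) * v x `^ t.
    have HU : U `^ (1 - t) * U^-1 `^ (1 - t) = 1.
      by rewrite -powRM ?invr_ge0 ?(ltW U0)// mulfV ?gt_eqF// powR1.
    have HV : V `^ t * V^-1 `^ t = 1.
      by rewrite -powRM ?invr_ge0 ?(ltW V0)// mulfV ?gt_eqF// powR1.
    transitivity ((U `^ (1 - t) * U^-1 `^ (1 - t)) * (V `^ t * V^-1 `^ t) *
      (u x `^ (1 - t) * v x `^ t)); first by rewrite /c; ring.
    by rewrite HU HV !mul1r.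
  apply: (le_trans H); rewrite /g le_eqVlt; apply/orP; left; apply/eqP; ring.
have ig : mu.-integrable D (EFin \o g).
  have -> : EFin \o g = (fun x => ((c * (1 - t) / U)%:E * (u x)%:E +
      (c * t / V)%:E * (v x)%:E)%E) by apply/funext => x.
  by apply: integrableD => //; exact: integrableZl.
have muv : measurable_fun D (fun x => u x `^ (1 - t) * v x `^ t).
  have mu_ : measurable_fun D u by apply/measurable_EFinP; exact: measurable_int iu.
  have mv_ : measurable_fun D v by apply/measurable_EFinP; exact: measurable_int iv.
  apply: measurable_funM.
    exact: (measurableT_comp (measurable_powR (1 - t)) mu_).
  exact: (measurableT_comp (measurable_powR t) mv_).
have iuv : mu.-integrable D (EFin \o (fun x => u x `^ (1 - t) * v x `^ t)).
  apply: (le_integrable mD _ _ ig); first exact/measurable_EFinP.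
  move=> x Dx /=; rewrite lee_fin ger0_norm ?mulr_ge0 ?powR_ge0//.
  exact: (le_trans (ug x Dx) (ler_norm _)).
split=> //.
apply: (@le_trans _ _ (\int[mu]_(x in D) g x)).
  by apply: le_Rintegral.
rewrite /g RintegralD//; last 2 first.
- have -> : EFin \o (fun x => c * (1 - t) / U * u x) =
    (fun x => ((c * (1 - t) / U)%:E * (u x)%:E)%E) by apply/funext.
  exact: integrableZl.
- have -> : EFin \o (fun x => c * t / V * v x) =
    (fun x => ((c * t / V)%:E * (v x)%:E)%E) by apply/funext.
  exact: integrableZl.
rewrite !RintegralZl// -/U -/V le_eqVlt; apply/orP; left; apply/eqP.
by rewrite -/c; field; rewrite !gt_eqF.
Qed.
End log_convexity.

(** * Interpolation bounds for log-convex solutions of a multiplicative recursion *)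

Section Bohr_Mollerup.
Context {R : realType} (f g : R -> R).
Hypothesis f_gt0 : forall r, 1 <= r -> 0 < f r.
Hypothesis g_gt0 : forall r, 1 <= r -> 0 < g r.
Hypothesis f_rec : forall r, 1 <= r -> f (r + 1) = g r * f r.
Hypothesis f_log_convex : forall a b t, 1 <= a -> 1 <= b -> 0 < t < 1 ->
  f ((1 - t) * a + t * b) <= f a `^ (1 - t) * f b `^ t.

(** Lower bound: x + 1 lies between x and x + 1 + w, with weight t = 1/(1 + w) on the latter, and f
    x = f (x + 1) / g x; raising to the power 1/t isolates f (x + 1 + w). Upper bound: x + 1 + w
    lies between x + 1 and x + 2. The factor [g] will be r for Gamma and r / Phi(r) for the
    moments. *)
Lemma log_convex_ratio (x w : R) : 1 <= x -> 0 < w <= 1 ->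
  f (x + 1) * g x `^ w <= f (x + 1 + w) <= f (x + 1) * g (x + 1) `^ w.
Proof.
move=> x1 /andP[w0 w1].
have xS : 1 <= x + 1 by lra.
have fS : 0 < f (x + 1) by exact: f_gt0.
have fw : 0 < f (x + 1 + w) by apply: f_gt0; lra.
have gx := g_gt0 x1; have gS := g_gt0 xS.
apply/andP; split.
  pose t := 1 / (1 + w).
  have w10 : 0 < 1 + w by lra.
  have t01 : 0 < t < 1 by rewrite /t divr_gt0//= ltr_pdivrMr//; lra.
  have := f_log_convex (a := x) (b := x + 1 + w) x1 _ t01.
  have -> : (1 - t) * x + t * (x + 1 + w) = x + 1 by rewrite /t; field; rewrite gt_eqF.
  move=> /(_ ltac:(lra)) H.
  have fx : f x = f (x + 1) / g x by rewrite f_rec// mulrAC mulfV ?gt_eqF// mul1r.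
  have [t0 t1] := andP t01.
  rewrite fx powRM ?invr_ge0 ?(ltW fS) ?(ltW gx)// in H.
  have H2 : f (x + 1) `^ t * g x `^ (1 - t) <= f (x + 1 + w) `^ t.
    have fE : f (x + 1) = f (x + 1) `^ (1 - t) * f (x + 1) `^ t.
      by rewrite -powRD ?subrK ?powRr1 ?(ltW fS)// gt_eqF// implybT.
    have p0 : 0 < f (x + 1) `^ (1 - t) by exact: powR_gt0.
    have gV : g x `^ (1 - t) * (g x)^-1 `^ (1 - t) = 1.
      by rewrite -powRM ?invr_ge0 ?(ltW gx)// mulfV ?gt_eqF// powR1.
    rewrite -(ler_pM2l p0) mulrA -fE.
    have q0 : 0 < g x `^ (1 - t) by exact: powR_gt0.
    rewrite -(ler_pM2r q0) in H; apply: (le_trans H).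
    rewrite le_eqVlt; apply/orP; left; apply/eqP.
    transitivity ((g x `^ (1 - t) * (g x)^-1 `^ (1 - t)) *
      (f (x + 1) `^ (1 - t) * f (x + 1 + w) `^ t)); last by rewrite gV mul1r.
    ring.
  have tV : 0 < t^-1 by rewrite invr_gt0.
  have := ge0_ler_powR (ltW tV) _ _ H2.
  rewrite !nnegrE mulr_ge0 ?powR_ge0// => /(_ isT isT).
  rewrite powRM ?powR_ge0// -!powRrM mulfV ?gt_eqF// !powRr1 ?(ltW fS) ?(ltW fw)//.
  have -> : (1 - t) / t = w by rewrite /t; field; rewrite gt_eqF.
  by [].
have [->|wn1] := eqVneq w 1.
  by rewrite f_rec// powRr1 ?(ltW gS)// mulrC.
have {}w1 : w < 1 by rewrite lt_neqAle wn1.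
have := f_log_convex (a := x + 1) (b := x + 1 + 1) (t := w) xS _ _.
rewrite w0 w1 => /(_ ltac:(lra) isT).
have -> : (1 - w) * (x + 1) + w * (x + 1 + 1) = x + 1 + w by ring.
move=> /le_trans; apply.
rewrite (f_rec xS) powRM ?(ltW fS) ?(ltW gS)// mulrCA -powRD; last first.
  by rewrite subrK oner_eq0.
by rewrite subrK powRr1 ?(ltW fS)// mulrC.
Qed.
End Bohr_Mollerup.

(** * The random walk embedded in a subordinator *)

Section finite_pushforward.
Context d1 d2 (T : measurableType d1) (S : measurableType d2) (R : realType).

(** A copy of [pushforward] that carries a finite-measure structure, so that product measures and
    Tonelli's theorem apply to laws taken under an unnormalised measure. *)
Definition fpushforward (Q : {finite_measure set T -> \bar R}) (f : {mfun T >-> S}) :=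
  pushforward Q f.

Variables (Q : {finite_measure set T -> \bar R}) (f : {mfun T >-> S}).

Let fpushforward0 : fpushforward Q f set0 = 0%E.
Proof. exact: measure0. Qed.

Let fpushforward_ge0 A : (0 <= fpushforward Q f A)%E.
Proof. exact: measure_ge0. Qed.

Let fpushforward_sigma_additive : semi_sigma_additive (fpushforward Q f).
Proof. exact: measure_semi_sigma_additive. Qed.

HB.instance Definition _ := isMeasure.Build _ _ _ (fpushforward Q f)
  fpushforward0 fpushforward_ge0 fpushforward_sigma_additive.

Let fpushforward_finite : fin_num_fun (fpushforward Q f).
Proof.
move=> A mA; apply: fin_num_measure.
by rewrite -[X in measurable X]setTI; exact: measurable_funP.
Qed.

HB.instance Definition _ :=
  @Measure_isFinite.Build _ S R (fpushforward Q f) fpushforward_finite.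
End finite_pushforward.

Section independence.
Context d1 d2 d3 (T : measurableType d1) (S : measurableType d2) (E : measurableType d3)
  (R : realType).
Local Open Scope ereal_scope.

(** The last hypothesis says at once that [eta] is independent of [Z] under [Q] and that its law
    there is that of [Y] under [P]. Rectangles determine the joint law as a product, and Tonelli
    concludes. [Q] will be P restricted to survival. *)
Lemma integral_indep (Q : {finite_measure set T -> \bar R}) (P : probability T R)
    (Z : T -> S) (eta Y : T -> E) (g : S * E -> \bar R) :
  measurable_fun [set: T] Z -> measurable_fun [set: T] eta ->
  measurable_fun [set: T] Y ->
  measurable_fun [set: S * E] g -> (forall z, 0 <= g z) ->
  (forall (C : set S) (B : set E), measurable C -> measurable B ->
     Q (Z @^-1` C `&` eta @^-1` B) = Q (Z @^-1` C) * P (Y @^-1` B)) ->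
  \int[Q]_w g (Z w, eta w) = \int[Q]_w \int[P]_w' g (Z w, Y w').
Proof.
move=> mZ meta mY mg g0 indep.
have mZe : measurable_fun [set: T] (fun w => (Z w, eta w)).
  exact: measurable_fun_pair.
pose fZ : {mfun T >-> S} := HB.pack Z (isMeasurableFun.Build _ _ _ _ _ mZ).
pose fY : {mfun T >-> E} := HB.pack Y (isMeasurableFun.Build _ _ _ _ _ mY).
pose fZe : {mfun T >-> (S * E)%type} :=
  HB.pack (fun w => (Z w, eta w)) (isMeasurableFun.Build _ _ _ _ _ mZe).
transitivity (\int[fpushforward Q fZe]_z g z).
  by rewrite /fpushforward ge0_integral_pushforward//; apply: in1W.
transitivity (\int[(fpushforward Q fZ \x fpushforward P fY)%E]_z g z).
  apply: eq_measure_integral => A mA _; apply/esym.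
  apply: product_measure_unique => // C B mC mB; rewrite /fpushforward /pushforward; exact: indep.
rewrite fubini_tonelli1// /fubini_F.
transitivity (\int[fpushforward Q fZ]_x \int[P]_w' g (x, Y w')).
  apply: eq_integral => x _.
  rewrite /fpushforward ge0_integral_pushforward//.
  exact: measurable_fun_pair2.
rewrite /fpushforward ge0_integral_pushforward//; last first.
  by move=> x _; exact: integral_ge0.
pose g' (z : S * T) := g (z.1, Y z.2).
apply: (@measurable_fun_fubini_tonelli_F _ _ _ _ _ P g') => //.
apply: (measurableT_comp mg); apply: measurable_fun_pair => //.
  by apply: measurableT_comp.
by move=> x; exact: g0.
Qed.

End independence.

Section expN.
Context {R : realType}.
Implicit Types x y : \bar R.

(** Real-valued, with 0 at +oo, so that killed paths contribute 0 to sums. *)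
Definition expN x : R := fine (expeR (- x)).

Lemma expN_EFin (r : R) : expN r%:E = expR (- r). Proof. by []. Qed.

Lemma expN_pinfty : expN +oo = 0. Proof. by []. Qed.

Lemma expN_ge0 x : 0 <= expN x.
Proof. exact/fine_ge0/expeR_ge0. Qed.

Lemma expNE x : expN x = \1_[set y | y \is a fin_num] x * expR (- fine x).
Proof.
rewrite indicE; case: x => [r||] /=.
- by rewrite mem_set// mul1r.
- by rewrite memNset// mul0r.
- by rewrite memNset// mul0r.
Qed.

Lemma measurable_expN : measurable_fun [set: \bar R] expN.
Proof.
rewrite (_ : expN = fun x => \1_[set y : \bar R | y \is a fin_num] x * expR (- fine x)); last first.
  by apply/funext => x; exact: expNE.
apply: measurable_funM.
  apply: measurable_indic; rewrite (_ : [set _ | _] = EFin @` setT).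
    apply: measurable_image_EFin; exact: measurableT.
  by apply/seteqP; split => [[r||]//= _|_ [r _ <-]//]; exists r.
apply: measurableT_comp; first exact: measurable_expR.
by apply: measurableT_comp => //; exact: fine_measurable.
Qed.

Lemma expN_le1 x : (0 <= x)%E -> expN x <= 1.
Proof. by case: x => [r||]//=; rewrite lee_fin => r0; rewrite expN_EFin -expR0 ler_expR oppr_le0. Qed.

Lemma expNEFin x : (0 <= x)%E -> expeR (- x) = (expN x)%:E.
Proof. by case: x. Qed.

Lemma expN_powR x (s : R) : 0 < s -> (0 <= x)%E -> expeR (- (s%:E * x)) = (expN x `^ s)%:E.
Proof.
move=> s0; case: x => [r||]//= r0.
  by rewrite expN_EFin; rewrite -expRM mulNr mulrC.
by rewrite gt0_muley ?lte_fin// expN_pinfty powR0// gt_eqF.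
Qed.

Lemma expN_le x y : (0 <= x)%E -> (x <= y)%E -> expN y <= expN x.
Proof.
case: x => [r||]//; case: y => [s||]//; rewrite ?lee_fin => r0 rs.
- by rewrite !expN_EFin ler_expR lerN2.
- by rewrite expN_pinfty expN_ge0.
Qed.

(** Finiteness of [x] makes the difference meaningful; a jump of [y] to +oo is included, both sides
    being 0. *)
Lemma expND x y : (0 <= x < +oo)%E -> (x <= y)%E -> expN y = expN x * expN (y - x).
Proof.
case: x => [r||]//; case: y => [s||]//= r0 rs.
- by rewrite -EFinB !expN_EFin -expRD; congr expR; lra.
- by rewrite addye// !expN_pinfty mulr0.
- by move: r0; rewrite ltxx andbF.
Qed.
End expN.

Section walk.
Context {d : measure_display} {T : measurableType d} {R : realType}
  (P : probability T R) (xi : R -> T -> \bar R) (xiP : subordinator P xi).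
Variables (h : R) (h0 : 0 < h).

Let hk (k : nat) : 0 <= k%:R * h. Proof. by rewrite mulr_ge0 ?ler0n// ltW. Qed.

#[local] Hint Extern 0 (is_true (0 <= _%:R * _)) => exact: hk : core.

Lemma subordinator_meas (t : R) : 0 <= t -> measurable_fun [set: T] (xi t).
Proof. by move=> t0; case: xiP => mxi _ _ _ _; exact: mxi. Qed.

Lemma subordinator_ge0 (t : R) w : 0 <= t -> (0 <= xi t w)%E.
Proof. by case: xiP => _ xi0 ndxi _ _ t0; rewrite -(xi0 w); exact: ndxi. Qed.

Definition wstep k w := expN (xi (k%:R * h) w).
Definition wsum k w := \sum_(i < k) wstep i.+1 w.
(** Cylinders over the mesh times 0, h, ..., kh: a pi-system, of the shape for which [subordinator]
    asserts independence. *)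
Definition past k := [set E : set T | exists2 Bs : 'I_k.+1 -> set (\bar R),
  (forall i, measurable (Bs i)) & E = [set w | forall i, Bs i (xi (i%:R * h) w)]].

Lemma past_measurable k : past k `<=` d.-measurable.
Proof.
move=> _ [Bs mBs ->].
rewrite (_ : [set _ | _] = \bigcap_(i in [set: 'I_k.+1]) (xi (i%:R * h) @^-1` Bs i)).
  apply: fin_bigcap_measurable; first exact: finite_finset.
  move=> i _; rewrite -[X in measurable X]setTI; apply: subordinator_meas => //.
by apply/seteqP; split=> w /= H i; [move=> _|]; exact: H.
Qed.

Lemma past_setI k : setI_closed (past k).
Proof.
move=> _ _ [Bs mBs ->] [Cs mCs ->].
exists (fun i => Bs i `&` Cs i); first by move=> i; exact: measurableI.
apply/seteqP; split=> w /=; first by move=> [HB HC] i; split; [exact: HB|exact: HC].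
by move=> H; split=> i; case: (H i).
Qed.

Lemma past_xi k i : (i <= k)%N ->
  measurable_fun [set: g_sigma_algebraType (past k)] (xi (i%:R * h)).
Proof.
move=> ik _ B mB; rewrite setTI; apply: sub_sigma_algebra.
pose i' : 'I_k.+1 := Ordinal (ik : (i < k.+1)%N).
exists (fun j => if j == i' then B else setT).
  by move=> j; case: ifP.
apply/seteqP; split=> w /=; first by move=> Bw j; case: eqP => // ->.
by move=> /(_ i'); rewrite eqxx.
Qed.

Lemma past_wstep k i : (i <= k)%N ->
  measurable_fun [set: g_sigma_algebraType (past k)] (wstep i).
Proof. by move=> ik; apply: measurableT_comp; [exact: measurable_expN|exact: past_xi]. Qed.

Lemma past_wsum k : measurable_fun [set: g_sigma_algebraType (past k)] (wsum k).
Proof. by apply: measurable_sum => i; exact: past_wstep. Qed.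

(** Meaningful on [walive k] only: after killing, the difference of two infinite values is a
    default. *)
Definition wincr k w := expN (xi (k.+1%:R * h) w - xi (k%:R * h) w)%E.
Definition walive k := [set w | (xi (k%:R * h) w < +oo)%E].

Lemma measurable_walive k : measurable (walive k).
Proof.
rewrite -[X in measurable X]setTI.
by apply: emeasurable_fun_infty_o => //; exact: subordinator_meas.
Qed.

Lemma measurable_wincr k : measurable_fun [set: T] (wincr k).
Proof.
apply: measurableT_comp; first exact: measurable_expN.
by apply: emeasurable_funB; exact: subordinator_meas.
Qed.

Lemma measurable_wstep k : measurable_fun [set: T] (wstep k).
Proof.
by apply: measurableT_comp; [exact: measurable_expN|exact: subordinator_meas].
Qed.

Lemma measurable_wsum k : measurable_fun [set: T] (wsum k).
Proof. by apply: measurable_sum => i; exact: measurable_wstep. Qed.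

(** As functions of the past event, both sides are finite measures that agree on cylinders, hence on
    the generated sigma-algebra, for which the pair [Z] is measurable. Restricting P to [walive k]
    replaces conditioning on survival. *)
Lemma walk_indep k (C : set (R * R)) (B : set R) : measurable C -> measurable B ->
  let Z := fun w => (wsum k w, wstep k w) in
  mrestr P (measurable_walive k) (Z @^-1` C `&` wincr k @^-1` B) =
  (mrestr P (measurable_walive k) (Z @^-1` C) * P (wstep 1 @^-1` B))%E.
Proof.
move=> mC mB Z.
have mVB : measurable (walive k `&` wincr k @^-1` B).
  apply: measurableI; first exact: measurable_walive.
  by rewrite -[X in measurable X]setTI; exact: measurable_wincr.
have mB1 : measurable (wstep 1 @^-1` B).
  by rewrite -[X in measurable X]setTI; exact: measurable_wstep.
have c0 : 0 <= fine (P (wstep 1 @^-1` B)) by exact/fine_ge0/measure_ge0.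
pose c := NngNum c0.
pose m1 := mrestr P mVB.
pose m2 := mscale c (mrestr P (measurable_walive k)).
have m12 : forall E, <<s past k >> E -> m1 E = m2 E.
  apply: (@g_sigma_algebra_measure_unique _ _ _ (past k) _ (fun=> setT)).
  - exact: past_measurable.
  - move=> _; exists (fun=> setT) => //.
    by apply/seteqP; split.
  - by rewrite bigcup_const.
  - exact: past_setI.
  - move=> _ [Bs mBs ->].
    case: xiP => _ _ _ _ indep.
    set E := [set w | _].
    change (P (E `&` (walive k `&` wincr k @^-1` B)) =
      ((fine (P (wstep 1 @^-1` B)))%:E * P (E `&` walive k))%E).
    rewrite fineK ?fin_num_measure// muleC.
    have -> : E `&` walive k =
        [set w | (xi (k%:R * h) w < +oo)%E /\ forall i : 'I_k.+1, Bs i (xi (i%:R * h) w)].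
      by apply/seteqP; split=> w /= [].
    have -> : wstep 1 @^-1` B = [set w | (expN @^-1` B) (xi h w)].
      by apply/seteqP; split=> w /=; rewrite /wstep mul1r.
    rewrite -(indep (k%:R * h) h (hk k) (ltW h0)).
    + congr (P _); apply/seteqP; split=> w /=; rewrite /wincr -[in k.+1%:R]addn1 natrD mulrDl mul1r.
        by move=> [Ew [Vw ew]].
      by move=> [Vw [ew Ew]].
    + by move=> i; rewrite hk/= ler_pM2r// ler_nat -ltnS.
    + by [].
    + by rewrite -[X in measurable X]setTI; exact: measurable_expN.
  - by move=> _; rewrite ltey_eq fin_num_measure//; exact: measurableI.
have ZC : <<s past k >> (Z @^-1` C).
  have mZ : measurable_fun [set: g_sigma_algebraType (past k)] Z.
    by apply: measurable_fun_pair; [exact: past_wsum|exact: past_wstep].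
  by have := mZ measurableT C mC; rewrite setTI.
have := m12 _ ZC.
change ((P (Z @^-1` C `&` (walive k `&` wincr k @^-1` B)) =
  (fine (P (wstep 1 @^-1` B)))%:E * P (Z @^-1` C `&` walive k))%E ->
  (P (Z @^-1` C `&` wincr k @^-1` B `&` walive k) =
  P (Z @^-1` C `&` walive k) * P (wstep 1 @^-1` B))%E).
by rewrite fineK ?fin_num_measure// muleC (setIC (walive k)) setIA.
Qed.

End walk.

(** The complement of V is null for the restricted measure, and inside V the two measures
    coincide. *)
Lemma ge0_integral_mrestr (d : measure_display) (T : measurableType d) (R : realType)
    (mu : {measure set T -> \bar R}) (V : set T) (mV : measurable V) (f : T -> \bar R) :
  measurable_fun [set: T] f -> (forall x, 0 <= f x)%E ->
  (\int[mrestr mu mV]_x f x = \int[mu]_(x in V) f x)%E.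
Proof.
move=> mf f0.
have mVC : measurable (~` V) by exact: measurableC.
rewrite -(setUv V) ge0_integral_setU//; last 2 first.
- by rewrite setUv.
- by apply/disj_setPS; rewrite setICr.
rewrite [X in (_ + X)%E](_ : _ = 0%E); last first.
  apply: null_set_integral => //; first by apply: measurable_funS mf.
  change (mu (~` V `&` V) = 0)%E.
  by rewrite setICl measure0.
rewrite adde0; apply: eq_measure_integral => A mA AV.
change (mu (A `&` V) = mu A).
by rewrite setIidl.
Qed.

(** * The transition operator of the walk *)

Section walk_step.
Context {d : measure_display} {T : measurableType d} {R : realType}
  (P : probability T R) (xi : R -> T -> \bar R) (xiP : subordinator P xi).
Variables (h : R) (h0 : 0 < h).
Local Open Scope ereal_scope.

Local Notation A := (wsum xi h).
Local Notation X := (wstep xi h).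
Local Notation Y := (wstep xi h 1).

(** From (a, x) the chain of pairs (sum, current factor) moves to (a + x Y, x Y), where Y has the
    law of e^(-xi_h). *)
Definition wop (g : R * R -> \bar R) (z : R * R) : \bar R :=
  \int[P]_w g (z.1 + z.2 * Y w, z.2 * Y w)%R.

Lemma wop_ge0 g : (forall z, 0 <= g z) -> forall z, 0 <= wop g z.
Proof. by move=> g0 z; exact: integral_ge0. Qed.

Lemma measurable_wop g : measurable_fun [set: R * R] g -> (forall z, 0 <= g z) ->
  measurable_fun [set: R * R] (wop g).
Proof.
move=> mg g0.
pose g' (z : (R * R) * T) := g (z.1.1 + z.1.2 * Y z.2, z.1.2 * Y z.2)%R.
apply: (@measurable_fun_fubini_tonelli_F _ _ _ _ _ P g') => //.
  apply: (measurableT_comp mg).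
  have mY : measurable_fun [set: (R * R) * T] (fun z => Y z.2).
    by apply: measurableT_comp => //; exact: (measurable_wstep xiP h0).
  have m1 : measurable_fun [set: (R * R) * T] (fun z => z.1.1).
    by apply: (measurableT_comp measurable_fst).
  have m2 : measurable_fun [set: (R * R) * T] (fun z => z.1.2).
    by apply: (measurableT_comp measurable_snd).
  apply: measurable_fun_pair; last exact: measurable_funM.
  by apply: measurable_funD => //; exact: measurable_funM.
by move=> z; exact: g0.
Qed.

Lemma wsumS k w : A k.+1 w = (A k w + X k.+1 w)%R.
Proof. by rewrite /wsum big_ord_recr. Qed.

Lemma walk_step (k : nat) g : measurable_fun [set: R * R] g -> (forall z, 0 <= g z) ->
  \int[P]_w g (A k.+1 w, X k.+1 w) = \int[P]_w wop g (A k w, X k w).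
Proof.
move=> mg g0.
have mX i : measurable_fun [set: T] (X i) by exact: (measurable_wstep xiP h0).
have mA i : measurable_fun [set: T] (A i) by exact: (measurable_wsum xiP h0).
have mV := measurable_walive xiP (h := h) h0 k; set V := walive _ _ _ in mV.
have mVC : measurable (~` V) by exact: measurableC.
have mL : measurable_fun [set: T] (fun w => g (A k.+1 w, X k.+1 w)).
  by apply: measurableT_comp => //; exact: measurable_fun_pair.
have mRR : measurable_fun [set: T] (fun w => wop g (A k w, X k w)).
  apply: measurableT_comp => //; [exact: measurable_wop|exact: measurable_fun_pair].
have hk1 : (0 <= k%:R * h)%R by rewrite mulr_ge0 ?ler0n// ltW.
have hkS : (k%:R * h <= k.+1%:R * h)%R by rewrite ler_pM2r// ler_nat.
have ndxi w : xi (k%:R * h) w <= xi (k.+1%:R * h) w.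
  by case: xiP => _ _ + _ _; apply.
rewrite -(setUv V) ge0_integral_setU//; last 2 first.
- by rewrite setUv.
- by apply/disj_setPS; rewrite setICr.
rewrite ge0_integral_setU//; last 3 first.
- by rewrite setUv.
- by move=> w _; exact: wop_ge0.
- by apply/disj_setPS; rewrite setICr.
congr (_ + _).
  (* Survivors: the next factor is the current one times the increment, which independence replaces
     by a fresh copy of Y. *)
  pose g' (z : (R * R) * R) := g (z.1.1 + z.1.2 * z.2, z.1.2 * z.2)%R.
  have mg' : measurable_fun [set: (R * R) * R] g'.
    apply: (measurableT_comp mg).
    have m1 : measurable_fun [set: (R * R) * R] (fun z => z.1.1).
      by apply: (measurableT_comp measurable_fst).
    have m2 : measurable_fun [set: (R * R) * R] (fun z => z.1.2).
      by apply: (measurableT_comp measurable_snd).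
    apply: measurable_fun_pair; last exact: measurable_funM.
    by apply: measurable_funD => //; exact: measurable_funM.
  transitivity (\int[P]_(w in V) g' ((A k w, X k w), wincr xi h k w)).
    apply: eq_integral => w /set_mem Vw; rewrite /g' /=.
    have <- : X k.+1 w = (X k w * wincr xi h k w)%R.
      by apply: expND => //; rewrite (subordinator_ge0 xiP).
    by rewrite wsumS.
  have mZg : measurable_fun [set: T] (fun w => g' (A k w, X k w, wincr xi h k w)).
    apply: (measurableT_comp mg'); apply: measurable_fun_pair;
      [exact: measurable_fun_pair|exact: (measurable_wincr xiP h0)].
  rewrite -(ge0_integral_mrestr P mV mZg); last by move=> w; exact: g0.
  rewrite (@integral_indep _ _ _ _ _ _ _ (mrestr P mV) P (fun w => (A k w, X k w))
     (wincr xi h k) Y g')//; last 4 first.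
  - exact: measurable_fun_pair.
  - exact: (measurable_wincr xiP h0).
  - by move=> z; exact: g0.
  - by move=> C B mC mB; exact: (walk_indep xiP h0).
  by rewrite ge0_integral_mrestr// => w; exact: wop_ge0.
(* Killed paths: the factor is 0 at both times, the sum no longer moves, and the operator integrates
   a constant against a probability. *)
apply: eq_integral => w /set_mem Vw.
have Ek : xi (k%:R * h) w = +oo by apply/eqP; rewrite -leye_eq leNgt; apply/negP.
have EkS : xi (k.+1%:R * h) w = +oo by apply/eqP; rewrite -leye_eq -Ek.
rewrite wsumS /wop /wstep Ek EkS expN_pinfty/=.
rewrite [RHS](_ : _ = \int[P]_x (cst (g (A k w + 0, 0)%R)) x); last first.
  by apply: eq_integral => x _; rewrite /= !mul0r.
rewrite integral_cst// -[LHS]mule1; congr (_ * _).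
by apply/esym; exact: probability_setT.
Qed.

End walk_step.

Section walk_moments.
Context {d : measure_display} {T : measurableType d} {R : realType}
  (P : probability T R) (xi : R -> T -> \bar R) (xiP : subordinator P xi).
Variables (h : R) (h0 : 0 < h).
Local Open Scope ereal_scope.

Local Notation A := (wsum xi h).
Local Notation X := (wstep xi h).
Local Notation Y := (wstep xi h 1).
Local Notation wop := (wop P xi h).

Lemma iter_wop_ge0 n g : (forall z, 0 <= g z) -> forall z, 0 <= iter n wop g z.
Proof. by move=> g0; elim: n => //= n IH; exact: wop_ge0. Qed.

Lemma measurable_iter_wop n g : measurable_fun [set: R * R] g -> (forall z, 0 <= g z) ->
  measurable_fun [set: R * R] (iter n wop g).
Proof.
move=> mg g0; elim: n => //= n IH.
by apply: (measurable_wop xiP h0) => //; exact: iter_wop_ge0.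
Qed.

Lemma walk_steps n k g : measurable_fun [set: R * R] g -> (forall z, 0 <= g z) ->
  \int[P]_w g (A (k + n)%N w, X (k + n)%N w) = \int[P]_w iter n wop g (A k w, X k w).
Proof.
move=> mg g0; elim: n k => [|n IH] k; first by rewrite addn0.
rewrite addnS -addSn IH.
rewrite (walk_step xiP h0 k (measurable_iter_wop n mg g0))//.
exact: iter_wop_ge0.
Qed.

(** Since xi_0 = 0, the chain starts at the deterministic point (0, 1), and averaging over the start
    is evaluation there. *)
Lemma walk_law n g : measurable_fun [set: R * R] g -> (forall z, 0 <= g z) ->
  \int[P]_w g (A n w, X n w) = iter n wop g (0, 1)%R.
Proof.
move=> mg g0; rewrite -[n in LHS]add0n walk_steps//.
rewrite (_ : \int[P]_w _ = \int[P]_w (cst (iter n wop g (0, 1)%R)) w); last first.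
  apply: eq_integral => w _ /=; rewrite /wsum big_ord0 /wstep mul0r.
  by case: xiP => _ -> _ _ _; rewrite expN_EFin oppr0 expR0.
rewrite integral_cst// -[RHS]mule1; congr (_ * _).
exact: probability_setT.
Qed.

Lemma iter_wop_shift n (c : R) g z :
  iter n wop (fun u => g (u.1 + c, u.2)%R) z = iter n wop g (z.1 + c, z.2)%R.
Proof.
elim: n z => [//|n IH] z /=; apply: eq_integral => w _.
by rewrite IH /= addrAC.
Qed.

(** One step of the chain is linear in (a, x): dilating the start dilates the whole path, so
    homogeneity passes to the iterates. *)
Lemma iter_wop_homogeneous n (p : R) (g : R * R -> \bar R) :
  measurable_fun [set: R * R] g -> (forall z, 0 <= g z) ->
  (forall c a x : R, (0 <= c)%R -> (0 <= a)%R -> (0 <= x)%R ->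
     g (c * a, c * x)%R = (c `^ p)%:E * g (a, x)) ->
  forall c a x : R, (0 <= c)%R -> (0 <= a)%R -> (0 <= x)%R ->
     iter n wop g (c * a, c * x)%R = (c `^ p)%:E * iter n wop g (a, x).
Proof.
move=> mg g0 hg; elim: n => [//|n IH] c a x c0 a0 x0 /=.
rewrite -ge0_integralZl//; last 3 first.
- have mY := measurable_wstep xiP h0 1.
  apply: (measurableT_comp (measurable_iter_wop n mg g0)).
  apply: measurable_fun_pair; last exact: measurable_funM.
  by apply: measurable_funD => //; exact: measurable_funM.
- by move=> w _; exact: iter_wop_ge0.
- by rewrite lee_fin powR_ge0.
apply: eq_integral => w _; rewrite -IH ?mulr_ge0 ?addr_ge0 ?mulr_ge0 ?expN_ge0//=.
by rewrite mulrDr !mulrA.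
Qed.

(** The outermost [wop] of the (n+1)-st iterate at (0, 1) is the first step, which leads to (Y, Y).
    Homogeneity extracts Y^p, of mean e^(-h phi), and leaves the n-th iterate at (1, 1), which by
    translation is the p-th moment of 1 + A_n. *)
Lemma walk_moment (p phi : R) n : (0 < p)%R ->
  \int[P]_w expeR (- (p%:E * xi h w)) = (expR (- (h * phi)))%:E ->
  \int[P]_w ((A n.+1 w) `^ p)%:E
    = (expR (- (h * phi)))%:E * \int[P]_w ((1 + A n w) `^ p)%:E.
Proof.
move=> p0 hphi.
pose g (z : R * R) := (z.1 `^ p)%:E.
have mg : measurable_fun [set: R * R] g.
  apply/measurable_EFinP; apply: (measurableT_comp (measurable_powR p)).
  exact: measurable_fst.
have g0 z : 0 <= g z by rewrite lee_fin powR_ge0.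
rewrite (walk_law n.+1 mg g0) /=.
pose g1 (z : R * R) := g (z.1 + 1, z.2)%R.
have -> : \int[P]_w ((1 + A n w) `^ p)%:E = iter n wop g (1, 1)%R.
  have := @iter_wop_shift n 1 g (0, 1)%R; rewrite /= add0r => <-.
  rewrite -walk_law//.
    by apply: eq_integral => w _; rewrite /g /= addrC.
  apply: (measurableT_comp mg); apply: measurable_fun_pair.
    by apply: measurable_funD => //; exact: measurable_fst.
  exact: measurable_snd.
have X0 w : (0 <= Y w)%R by exact: expN_ge0.
have hY : \int[P]_w ((Y w) `^ p)%:E = (expR (- (h * phi)))%:E.
  rewrite -hphi; apply: eq_integral => w _; rewrite expN_powR//.
    by rewrite /wstep mul1r.
  by apply: (subordinator_ge0 xiP); exact: ltW.
rewrite -hY -ge0_integralZr//; last 3 first.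
- apply/measurable_EFinP; apply: (measurableT_comp (measurable_powR p)).
  exact: (measurable_wstep xiP h0).
- by move=> w _; rewrite lee_fin powR_ge0.
- exact: iter_wop_ge0.
apply: eq_integral => w _.
rewrite /= add0r mul1r.
rewrite -[X in _ (X, _)](mulr1 (Y w)) -[X in _ (_, X)](mulr1 (Y w)).
rewrite (iter_wop_homogeneous n (p := p) mg g0)//.
by move=> c a x c0 a0 x0; rewrite /g /= powRM// EFinM.
Qed.

End walk_moments.

(** * Moments of the exponential functional *)

(** The quotient lies between a and a e^(ha), by e^t >= 1 + t at t = ha and t = -ha. *)
Lemma expR_diff_cvg (R : realType) (a : R) (h : R^nat) :
  (forall n, 0 < h n) -> h @ \oo --> 0 ->
  (fun n => (expR (h n * a) - 1) / h n) @ \oo --> a.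
Proof.
move=> h0 hx.
have ub : (fun n => a * expR (h n * a)) @ \oo --> a.
  rewrite -[X in _ --> X]mulr1 -(@expR0 R); apply: cvgM; first exact: cvg_cst.
  have ha0 : (fun n => h n * a) @ \oo --> 0 by rewrite -(mul0r a); apply: cvgMl.
  have := @continuous_cvg _ _ _ _ _ _ (@expR R) (0:R) (@continuous_expR R 0) ha0.
  by apply.
apply: (squeeze_cvgr _ (cvg_cst a) ub); near=> n.
have := h0 n; move: (h n) => {ub hx h0}h h0.
rewrite ler_pdivlMr// ler_pdivrMr//; apply/andP; split.
  by have := expR_ge1Dx (h * a); lra.
have := expR_ge1Dx (- (h * a)); rewrite expRN.
have e0 := expR_gt0 (h * a); set e := expR _ in e0 *.
rewrite -(ler_pM2l e0) mulfV ?gt_eqF//; lra.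
Unshelve. all: by end_near. Qed.

Section moment_recursion.
Context {d : measure_display} {T : measurableType d} {R : realType}.
Local Open Scope ereal_scope.

(** The mean of the quotient [f n] is known exactly from the last hypothesis, and pointwise it tends
    to p I^(p-1) where I > 0. What remains is a dominating function, found differently for p >= 1
    and p <= 1. *)
Lemma moment_recursion (P : probability T R) (I : T -> R) (D : nat -> T -> R)
    (h : nat -> R) (a p : R) : (0 < p)%R ->
  (forall n, 0 < h n <= 1)%R -> h @ \oo --> (0%R : R) ->
  (forall n, measurable_fun [set: T] (D n)) -> measurable_fun [set: T] I ->
  (forall n w, 0 <= D n w <= I w)%R -> (forall n w, I w <= D n w + h n)%R ->
  {ae P, forall w, (0 < I w)%R} ->
  P.-integrable [set: T] (fun w => (I w `^ p)%:E) ->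
  (forall n, \int[P]_w ((D n w + h n) `^ p)%:E
     = (expR (h n * a))%:E * \int[P]_w (D n w `^ p)%:E) ->
  P.-integrable [set: T] (fun w => (I w `^ (p - 1))%:E) /\
  p%:E * \int[P]_w (I w `^ (p - 1))%:E = a%:E * \int[P]_w (I w `^ p)%:E.
Proof.
move=> p0 h01 hx mD mI DI IDh I0 iIp HD.
have h0 n : (0 < h n)%R by case/andP: (h01 n).
have I_ge0 w : (0 <= I w)%R by case/andP: (DI 0%N w) => ? /(le_trans _); exact.
have D_ge0 n w : (0 <= D n w)%R by case/andP: (DI n w).
have mpow q (f : T -> R) : measurable_fun [set: T] f ->
    measurable_fun [set: T] (fun w => (f w `^ q)%:E).
  by move=> mf; apply/measurable_EFinP; apply: (measurableT_comp (measurable_powR q)).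
have DcvgI w : D ^~ w @ \oo --> I w.
  have lb : (fun n => I w - h n)%R @ \oo --> I w.
    by rewrite -[X in _ --> X]subr0; apply: cvgB => //; exact: cvg_cst.
  apply: (squeeze_cvgr _ lb (cvg_cst (I w))); near=> n.
  by case/andP: (DI n w) => _ ->; rewrite lerBlDr IDh.
have iDp n : P.-integrable [set: T] (fun w => (D n w `^ p)%:E).
  apply: le_integrable iIp => //; first exact: mpow.
  move=> w _ /=; rewrite lee_fin !ger0_norm ?powR_ge0//.
  by case/andP: (DI n w) => *; rewrite ge0_ler_powR ?nnegrE ?(ltW p0).
have cDp : \int[P]_w (D n w `^ p)%:E @[n --> \oo] --> \int[P]_w (I w `^ p)%:E.
  have [] := @dominated_convergence _ _ _ P setT measurableT
    (fun n w => (D n w `^ p)%:E) (fun w => (I w `^ p)%:E) (fun w => (I w `^ p)%:E) => //.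
  - by move=> n; exact: mpow.
  - exact: mpow.
  - apply: aeW => w _; apply: cvg_EFin; first by near=> n.
    apply: powR_cvg_nneg => //; exact: DcvgI.
  - apply: aeW => w n _ /=; rewrite lee_fin ger0_norm ?powR_ge0//.
    by case/andP: (DI n w) => *; rewrite ge0_ler_powR ?nnegrE ?(ltW p0).
pose f n w := (((D n w + h n) `^ p - D n w `^ p) / h n)%R.
have f_ge0 n w : (0 <= f n w)%R.
  by rewrite /f divr_ge0 ?(ltW (h0 n)) ?powR_diff_ge0 ?(ltW p0).
have mf n : measurable_fun [set: T] (fun w => (f n w)%:E).
  apply/measurable_EFinP; apply: measurable_funM => //.
  apply: measurable_funB; apply/measurable_EFinP; apply: mpow => //.
  exact: measurable_funD.
have intf n : \int[P]_w (f n w)%:E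
    = ((expR (h n * a) - 1) / h n)%:E * \int[P]_w (D n w `^ p)%:E.
  have iDhp : P.-integrable [set: T] (fun w => ((D n w + h n) `^ p)%:E).
    apply/integrableP; split; first by apply: mpow; exact: measurable_funD.
    under eq_integral do rewrite gee0_abs ?lee_fin ?powR_ge0//.
    rewrite HD ltey_eq fin_numM//; exact: integrable_fin_num.
  under eq_integral do rewrite /f mulrC EFinM EFinB.
  rewrite integralZl//; last exact: integrableB.
  rewrite integralB// HD [in RHS]mulrC [in RHS]EFinM -muleA; congr (_ * _).
  have /fineK <- := integrable_fin_num measurableT (iDp n).
  by rewrite -!EFinM -EFinB mulrBl mul1r.
have cintf : \int[P]_w (f n w)%:E @[n --> \oo] --> a%:E * \int[P]_w (I w `^ p)%:E.
  under eq_cvg do rewrite intf.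
  have /fineK E := integrable_fin_num measurableT iIp.
  apply: cvgeM; last exact: cDp; last first.
    by apply: cvg_EFin; [near=> n|exact: expR_diff_cvg].
  by rewrite -E.
have cf w : (0 < I w)%R -> (f n w)%:E @[n --> \oo] --> (p * I w `^ (p - 1))%:E.
  by move=> Iw; apply: cvg_EFin; [near=> n|exact: powR_diff_cvg].
have mI1 : measurable_fun [set: T] (fun w => (p * I w `^ (p - 1))%:E).
  apply/measurable_EFinP; apply: measurable_funM => //.
  by apply/measurable_EFinP; exact: mpow.
suff [g [ig fg]] : exists g : T -> \bar R, P.-integrable [set: T] g /\
    {ae P, forall w, forall n, [set: T] w -> `|(f n w)%:E| <= g w}.
  have [||iI1 _ c1] := @dominated_convergence _ _ _ P setT measurableT
    (fun n w => (f n w)%:E) (fun w => (p * I w `^ (p - 1))%:E) g _ mI1 _ ig fg.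
  - exact: mf.
  - by apply: filterS I0 => w Iw _; exact: cf.
  have E : \int[P]_w (p * I w `^ (p - 1))%:E = a%:E * \int[P]_w (I w `^ p)%:E.
    exact: (cvg_unique _ c1 cintf).
  split.
    have : P.-integrable [set: T] (fun w => (p^-1)%:E * (p * I w `^ (p - 1))%:E).
      exact: integrableZl.
    apply: eq_integrable => // w _.
    by rewrite -EFinM mulrA mulVf ?gt_eqF// mul1r.
  rewrite -E; under [RHS]eq_integral do rewrite EFinM.
  rewrite ge0_integralZl//; first exact: mpow.
  - by move=> w _; rewrite lee_fin powR_ge0.
  - by rewrite lee_fin ltW.
(* For p >= 1 the quotient is at most p (D + h)^(p-1) <= p (I + 1)^p because h <= 1, and this is
   controlled by I^p + 1. *)
have [p1|/ltW p1] := leP 1%R p.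
  exists (fun w => (p * 2 `^ p * (I w `^ p + 1))%:E); split.
    apply: (@eq_integrable _ _ _ P _ measurableT
      (fun w => (p * 2 `^ p)%:E * ((I w `^ p)%:E + (EFin \o cst 1%R) w))).
      by move=> w _.
    apply: integrableZl => //; apply: integrableD => //.
    exact: finite_measure_integrable_cst.
  apply: aeW => w n _; rewrite gee0_abs ?lee_fin//.
  rewrite /f ler_pdivrMr//.
  apply: (le_trans (powR_diff_le_ge1 p1 (D_ge0 n w) (h0 n))).
  rewrite mulrAC ler_pM2r// -mulrA ler_pM2l//.
  have I1 : (0 <= I w + 1)%R by rewrite addr_ge0.
  case/andP: (h01 n) => _ h1; case/andP: (DI n w) => _ DIw.
  apply: (@le_trans _ _ ((I w + 1) `^ (p - 1))%R).
    rewrite ge0_ler_powR ?subr_ge0 ?nnegrE ?addr_ge0 ?(ltW (h0 n))//.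
    exact: lerD.
  apply: (@le_trans _ _ ((I w + 1) `^ p)%R).
    by rewrite ler_powR ?lerDr// gerBl.
  by apply: (le_trans (powRD_le (ltW p0) _ _)) => //; rewrite powR1.
(* For p <= 1 the bound is I^(p-1) itself, since D + h >= I and the exponent is nonpositive. *)
have fI n w : (0 < I w)%R -> (f n w <= I w `^ (p - 1))%R.
  move=> Iw; rewrite /f ler_pdivrMr// mulrC.
  apply: (le_trans (powR_diff_le_le1 p0 p1 (D_ge0 n w) (h0 n))).
  by rewrite ler_pM2l// ler_powR_npos// subr_le0.
exists (fun w => (I w `^ (p - 1))%:E); split; last first.
  by apply: filterS I0 => w Iw n _; rewrite gee0_abs lee_fin ?f_ge0// fI.
apply/integrableP; split; first exact: mpow.
under eq_integral do rewrite gee0_abs ?lee_fin ?powR_ge0//.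
(* Fatou's lemma bounds the mean of the limit by the limit of the means, which is finite because I^p
   is integrable; hence the candidate I^(p-1) is integrable. *)
have F : \int[P]_w (p * I w `^ (p - 1))%:E <= a%:E * \int[P]_w (I w `^ p)%:E.
  rewrite -(cvg_limn_einf_sup cintf).1.
  apply: le_trans (fatou P measurableT mf _); last by move=> n w _; rewrite lee_fin.
  apply: ae_ge0_le_integral => //.
  - by move=> w _; rewrite lee_fin mulr_ge0 ?powR_ge0// ltW.
  - move=> w _; rewrite limn_einf_lim; apply: lime_ge; first exact: is_cvg_einfs.
    apply: nearW => n; apply: le_ereal_inf_tmp => _ [m _ <-].
    by rewrite lee_fin.
  - rewrite (_ : (fun w => _) = (fun w => - limn_esup (fun n => - (f n w)%:E))).
      by apply: measurableT_comp => //; apply: measurable_fun_limn_esup => n;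
        exact: measurableT_comp.
    by apply/funext => w; rewrite -[in LHS](oppeK (limn_einf _)) -limn_esupN.
  - by apply: filterS I0 => w Iw _; rewrite (cvg_limn_einf_sup (cf w Iw)).1.
have fin : a%:E * \int[P]_w (I w `^ p)%:E < +oo.
  by rewrite ltey_eq fin_numM// integrable_fin_num.
have {F fin} := le_lt_trans F fin.
rewrite (_ : \int[P]_w (p * _)%:E = p%:E * \int[P]_w (I w `^ (p - 1))%:E).
  by rewrite !ltey; apply: contra => /eqP ->; rewrite gt0_muley ?lte_fin.
under eq_integral do rewrite EFinM.
rewrite ge0_integralZl//.
- exact: mpow.
- by move=> w _; rewrite lee_fin powR_ge0.
- by rewrite lee_fin ltW.
Unshelve. all: by end_near. Qed.
End moment_recursion.

(** * Moment bounds uniform in the number of steps *)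

Section walk_bound.
Context {d : measure_display} {T : measurableType d} {R : realType}
  (P : probability T R) (xi : R -> T -> \bar R) (xiP : subordinator P xi).
Variables (h : R) (h0 : 0 < h).
Local Open Scope ereal_scope.

(** The right-endpoint Riemann sum of exp(-xi) over n cells of width h. *)
Definition rsum n w := (h * wsum xi h n w)%R.

Lemma rsum_ge0 n w : (0 <= rsum n w)%R.
Proof.
by rewrite mulr_ge0 ?(ltW h0)// sumr_ge0// => i _; exact: expN_ge0.
Qed.

Lemma measurable_rsum n : measurable_fun [set: T] (rsum n).
Proof. by apply: measurable_funM => //; exact: (measurable_wsum xiP h0). Qed.

Lemma rsum_ndecr w : {homo (rsum ^~ w) : n m / (n <= m)%N >-> (n <= m)%R}.
Proof.
apply/nondecreasing_seqP => n; rewrite /rsum wsumS ler_pM2l// lerDl; exact: expN_ge0.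
Qed.

Variables (p phi : R) (p0 : (0 < p)%R).
Hypothesis hphi : \int[P]_w expeR (- (p%:E * xi h w)) = (expR (- (h * phi)))%:E.

Let mpow (f : T -> R) : measurable_fun [set: T] f ->
  measurable_fun [set: T] (fun w => (f w `^ p)%:E).
Proof.
by move=> mf; apply/measurable_EFinP; apply: (measurableT_comp (measurable_powR p)).
Qed.

Lemma rsum_moment n :
  \int[P]_w ((h + rsum n w) `^ p)%:E
    = (expR (h * phi))%:E * \int[P]_w (rsum n.+1 w `^ p)%:E.
Proof.
have mA k := measurable_wsum xiP h0 k.
have A0 k w : (0 <= wsum xi h k w)%R by rewrite sumr_ge0// => i _; exact: expN_ge0.
have -> : \int[P]_w (rsum n.+1 w `^ p)%:E =
    (h `^ p)%:E * \int[P]_w (wsum xi h n.+1 w `^ p)%:E.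
  rewrite -ge0_integralZl//; last 3 first.
  - exact: mpow.
  - by move=> w _; rewrite lee_fin powR_ge0.
  - by rewrite lee_fin powR_ge0.
  by apply: eq_integral => w _; rewrite powRM ?(ltW h0)// ?A0.
rewrite (walk_moment xiP h0 n p0 hphi) muleCA (muleA (expR _)%:E).
rewrite -EFinM -expRD subrr expR0 mul1e.
rewrite -ge0_integralZl//; last 3 first.
- by apply: mpow; exact: measurable_funD.
- by move=> w _; rewrite lee_fin powR_ge0.
- by rewrite lee_fin powR_ge0.
apply: eq_integral => w _; rewrite -EFinM -powRM ?addr_ge0// ?(ltW h0)//.
by rewrite mulrDr mulr1.
Qed.

(** The moments M_n satisfy M_(n+1) <= q (b M_n + h^p c) with q = e^(-h phi) < 1. The choice of b
    makes q b = (1 + q)/2 < 1, so this is a contraction, and C is its fixed point. *)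
Lemma rsum_moment_bound : (0 < phi)%R ->
  exists C : R, forall n, \int[P]_w (rsum n w `^ p)%:E <= C%:E.
Proof.
move=> phi0.
pose q := expR (- (h * phi)).
have q0 : (0 < q)%R by exact: expR_gt0.
have q1 : (q < 1)%R by rewrite /q -expR0 ltr_expR oppr_lt0 mulr_gt0.
pose b := ((1 + q) / (2 * q))%R.
have b1 : (1 < b)%R by rewrite /b ltr_pdivlMr ?mulr_gt0//; lra.
have qb : (q * b = (1 + q) / 2)%R by rewrite /b; field; rewrite gt_eqF.
have [c [c0 hc]] := powR_addl_split p0 b1.
pose C := (h `^ p * c * q / (1 - q * b))%R.
have qb1 : (0 < 1 - q * b)%R by rewrite qb; lra.
exists C; elim=> [|n IH].
  rewrite (_ : \int[P]_w _ = 0); first by rewrite lee_fin !mulr_ge0 ?powR_ge0 ?invr_ge0// ltW.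
  by apply: integral0_eq => w _; rewrite /rsum /wsum big_ord0 mulr0 powR0// gt_eqF.
have -> : \int[P]_w (rsum n.+1 w `^ p)%:E = q%:E * \int[P]_w ((h + rsum n w) `^ p)%:E.
  by rewrite rsum_moment muleA -EFinM -expRD addNr expR0 mul1e.
have -> : C = (q * (b * C + h `^ p * c))%R.
  by rewrite /C; field; rewrite gt_eqF.
rewrite EFinM lee_pmul2l//.
apply: (@le_trans _ _ (\int[P]_w (b%:E * (rsum n w `^ p)%:E + (h `^ p * c)%:E))).
  apply: ge0_le_integral => //.
  - by move=> w _; rewrite lee_fin powR_ge0.
  - by apply: mpow; apply: measurable_funD => //; exact: measurable_rsum.
  - by apply: emeasurable_funD => //; apply: emeasurable_funM => //; apply: mpow; exact: measurable_rsum.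
  move=> w _; rewrite -EFinM -EFinD lee_fin.
  have -> : (h + rsum n w = h * (1 + rsum n w / h))%R.
    by field; rewrite gt_eqF.
  rewrite powRM ?addr_ge0 ?divr_ge0 ?rsum_ge0 ?(ltW h0)//.
  have -> : (rsum n w `^ p = h `^ p * (rsum n w / h) `^ p)%R.
    rewrite -powRM ?divr_ge0 ?rsum_ge0 ?(ltW h0)//.
    by rewrite mulrCA mulfV ?gt_eqF// mulr1.
  rewrite mulrCA -mulrDr ler_wpM2l ?powR_ge0//.
  by apply: hc; rewrite divr_ge0 ?rsum_ge0 ?(ltW h0).
have c1 : (0 <= h `^ p * c)%R by rewrite mulr_ge0 ?powR_ge0.
have bp : (0 <= b)%R by rewrite ltW// (lt_trans ltr01).
rewrite ge0_integralD//; last 2 first.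
- by move=> w _; rewrite -EFinM lee_fin mulr_ge0 ?powR_ge0.
- by apply: emeasurable_funM => //; apply: mpow; exact: measurable_rsum.
rewrite integral_cst//= EFinD; apply: leeD; last first.
  rewrite -[leRHS]mule1; apply: lee_wpmul2l; first by rewrite lee_fin.
  exact: probability_le1.
rewrite ge0_integralZl//; last 2 first.
- by apply: mpow; exact: measurable_rsum.
- by move=> w _; rewrite lee_fin powR_ge0.
by rewrite (EFinM b C); apply: lee_wpmul2l; rewrite ?lee_fin.
Qed.

End walk_bound.

(** * Riemann sums against the exponential functional *)

Section riemann.
Context {d : measure_display} {T : measurableType d} {R : realType}
  (P : probability T R) (xi : R -> T -> \bar R) (xiP : subordinator P xi).
Variables (h : R) (h0 : 0 < h).
Local Open Scope ereal_scope.

(** The sum D of the overview, extended-valued because finiteness is proved only almost surely. *)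
Definition rlim w := limn (fun n => (rsum xi h n w)%:E).

Let cell (k : nat) : set R := `[k%:R * h, k.+1%:R * h[%classic%R.

Lemma bigcup_cell : \bigcup_k cell k = `[0%R, +oo[%classic.
Proof.
apply/seteqP; split=> x /=.
  move=> [k _]; rewrite /cell/= !in_itv/= andbT => /andP[+ _].
  by apply: le_trans; rewrite mulr_ge0 ?ler0n// ltW.
rewrite in_itv/= andbT => x0; exists (Num.truncn (x / h)) => //.
have /truncn_itv /andP[] : (0 <= x / h)%R by rewrite divr_ge0// ltW.
by rewrite /cell/= in_itv/= ler_pdivlMr// ltr_pdivrMr// => -> ->.
Qed.

Lemma trivIset_cell : trivIset [set: nat] cell.
Proof.
apply: ltn_trivIset => i j ij; apply/seteqP; split=> // x [] /=.
rewrite /cell/= !in_itv/= => /andP[_ xi1] /andP[xj _].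
have : (j.+1%:R * h <= i%:R * h)%R by rewrite ler_pM2r// ler_nat.
by move=> /(lt_le_trans xi1)/lt_le_trans/(_ xj); rewrite ltxx.
Qed.

Lemma expN_xi_le w (s t : R) : (0 <= s <= t)%R -> (expN (xi t w) <= expN (xi s w))%R.
Proof.
move=> /andP[s0 st]; apply: expN_le; first exact: (subordinator_ge0 xiP).
by case: xiP => _ _ + _ _; apply.
Qed.

Lemma expeR_xiE w (t : R) : (0 <= t)%R -> expeR (- xi t w) = (expN (xi t w))%:E.
Proof. by move=> t0; rewrite expNEFin//; exact: (subordinator_ge0 xiP). Qed.

Lemma measurable_path w :
  measurable_fun (`[0%R, +oo[%classic : set R) (fun l => expeR (- xi l w)).
Proof.
(* A monotone function is Borel: freezing the path to the left of 0 makes it monotone on the whole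
   line, and the inner sign turns nonincreasing into nondecreasing. *)
apply: (@eq_measurable_fun _ _ R (\bar R) _
  (fun l => (- - expN (xi (Num.max l 0%R) w))%R%:E)).
  move=> l; rewrite inE/= in_itv/= andbT => l0.
  by rewrite opprK expeR_xiE// max_l.
apply/measurable_EFinP; apply: measurableT_comp => //.
apply: nondecreasing_measurable => // s t st.
rewrite lerN2; apply: expN_xi_le; rewrite le_max lexx orbT/=.
by rewrite ge_max !le_max st lexx orbT.
Qed.

Lemma expfun_cells w :
  expfun xi w = limn (fun n => \sum_(0 <= k < n) \int[lebesgue_measure]_(l in cell k) expeR (- xi l w)).
Proof.
rewrite /expfun -bigcup_cell ge0_integral_bigcup//.
- by move=> k; exact: measurable_itv.
- by rewrite bigcup_cell; exact: measurable_path.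
- by move=> l _; exact: expeR_ge0.
- exact: trivIset_cell.
Qed.

Lemma cell_bounds w k :
  (h * wstep xi h k.+1 w)%:E <= \int[lebesgue_measure]_(l in cell k) expeR (- xi l w)
  <= (h * wstep xi h k w)%:E.
Proof.
have kh : (0 <= k%:R * h)%R by rewrite mulr_ge0 ?ler0n// ltW.
have mcell : measurable (cell k) by exact: measurable_itv.
have sub : cell k `<=` `[0%R, +oo[%classic.
  by rewrite -bigcup_cell => x kx; exists k.
have mf : measurable_fun (cell k) (fun l => expeR (- xi l w)).
  by apply: measurable_funS (measurable_path w); first exact: measurable_itv.
have cst_int (c : R) : \int[lebesgue_measure]_(l in cell k) (cst c%:E l) = (h * c)%:E.
  have mc : lebesgue_measure (cell k) = h%:E.
    rewrite /cell lebesgue_measure_itv/= lte_fin ltr_pM2r// ltr_nat ltnSn.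
    by rewrite -EFinB -mulrBl -natrB ?leqnSn// subSnn mul1r.
  rewrite integral_cst// mulrC EFinM; congr (_ * _); exact: mc.
rewrite -!cst_int; apply/andP; split; apply: ge0_le_integral => //.
- by move=> l _; rewrite lee_fin expN_ge0.
- move=> l; rewrite /cell/= in_itv/= => /andP[kl lk].
  rewrite expeR_xiE; last exact: le_trans kl.
  by rewrite lee_fin; apply: expN_xi_le; rewrite (le_trans kh kl) ltW.
- by move=> l _; exact: expeR_ge0.
- move=> l; rewrite /cell/= in_itv/= => /andP[kl lk].
  rewrite expeR_xiE; last exact: le_trans kl.
  by rewrite lee_fin; apply: expN_xi_le; rewrite kh.
Qed.

Lemma is_cvg_rsum w : cvgn (fun n => (rsum xi h n w)%:E).
Proof.
apply: ereal_nondecreasing_is_cvgn => n m nm; rewrite lee_fin.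
exact: rsum_ndecr.
Qed.

Lemma rlim_ge0 w : 0 <= rlim w.
Proof.
apply: lime_ge; first exact: is_cvg_rsum.
by apply: nearW => n; rewrite lee_fin; exact: rsum_ge0.
Qed.

Lemma rsumE n w : (rsum xi h n w)%:E = \sum_(0 <= k < n) (h * wstep xi h k.+1 w)%:E.
Proof. by rewrite /rsum /wsum mulr_sumr -sumEFin big_mkord. Qed.

Lemma wstep0 w : wstep xi h 0 w = 1%R.
Proof. by rewrite /wstep mul0r; case: xiP => _ -> _ _ _; rewrite expN_EFin oppr0 expR0. Qed.

(** For n > 0 the left-endpoint sum is h X_0 = h plus the right-endpoint sum over n - 1 cells. *)
Lemma rsum_left n w : \sum_(0 <= k < n) (h * wstep xi h k w)%:E <= (h + rsum xi h n w)%:E.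
Proof.
rewrite EFinD rsumE; case: n => [|n].
  by rewrite !big_nil adde0 lee_fin ltW.
rewrite big_nat_recl// wstep0 mulr1 leeD2l// [leRHS]big_nat_recr//=.
by rewrite leeDl// lee_fin mulr_ge0 ?(ltW h0)// expN_ge0.
Qed.

Lemma expfun_rlim w : rlim w <= expfun xi w <= rlim w + h%:E.
Proof.
have cJ : cvgn (fun n => \sum_(0 <= k < n) \int[lebesgue_measure]_(l in cell k) expeR (- xi l w)).
  apply: is_cvg_nneseries => n _ _; apply: integral_ge0 => l _; exact: expeR_ge0.
rewrite expfun_cells; apply/andP; split.
  apply: lee_lim => //; first exact: is_cvg_rsum.
  apply: nearW => n; rewrite rsumE; apply: lee_sum => k _.
  by case/andP: (cell_bounds w k).
have cr := @is_cvg_rsum w.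
have -> : rlim w + h%:E = limn (fun n => (rsum xi h n w)%:E + (fun=> h%:E) n).
  rewrite limeD//; first by rewrite lim_cst.
    exact: is_cvg_cst.
  by rewrite lim_cst// fin_num_adde_defl.
apply: lee_lim => //.
  apply: is_cvgeD => //; last exact: is_cvg_cst.
  by rewrite lim_cst// fin_num_adde_defl.
apply: nearW => n; rewrite -EFinD addrC; apply: le_trans (rsum_left n w).
by apply: lee_sum => k _; case/andP: (cell_bounds w k).
Qed.

Lemma measurable_rlim : measurable_fun [set: T] rlim.
Proof.
apply: (emeasurable_fun_cvg (fun n w => (rsum xi h n w)%:E)).
  by move=> n; apply/measurable_EFinP; exact: (measurable_rsum xiP h0).
by move=> w _; exact: is_cvg_rsum.
Qed.

End riemann.

Section walk_limit.
Context {d : measure_display} {T : measurableType d} {R : realType}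
  (P : probability T R) (xi : R -> T -> \bar R) (xiP : subordinator P xi)
  (Phi : R -> R).
Hypothesis laplace : forall l s : R, 0 <= l -> 0 < s ->
  (\int[P]_w expeR (- (s%:E * xi l w)))%E = (expR (- (l * Phi s)))%:E.
Hypothesis Phi_gt0 : forall s, 0 < s -> 0 < Phi s.
Local Open Scope ereal_scope.

(** The uniform moment bound at p = 1 with monotone convergence; this is the source of almost sure
    finiteness. *)
Lemma rlim_integrable (h : R) : (0 < h)%R -> P.-integrable [set: T] (rlim xi h).
Proof.
move=> h0.
apply/integrableP; split; first exact: (measurable_rlim xiP h0).
have [C hC] := rsum_moment_bound xiP h0 ltr01 (laplace (ltW h0) ltr01) (Phi_gt0 ltr01).
rewrite (_ : \int[P]_w `|rlim xi h w| = \int[P]_w rlim xi h w); last first.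
  by apply: eq_integral => w _; rewrite gee0_abs//; exact: (rlim_ge0 xi h0).
apply: (@le_lt_trans _ _ C%:E); last exact: ltry.
rewrite /rlim monotone_convergence//; last 3 first.
- by move=> n; apply/measurable_EFinP; exact: (measurable_rsum xiP h0).
- by move=> n w _; rewrite lee_fin; exact: rsum_ge0.
- by move=> w _ n m nm; rewrite lee_fin; exact: rsum_ndecr.
apply: lime_le.
  apply: ereal_nondecreasing_is_cvgn => n m nm; apply: ge0_le_integral => //.
  - by move=> w _; rewrite lee_fin; exact: rsum_ge0.
  - by apply/measurable_EFinP; exact: (measurable_rsum xiP h0).
  - by apply/measurable_EFinP; exact: (measurable_rsum xiP h0).
  - by move=> w _; rewrite lee_fin; exact: rsum_ndecr.
apply: nearW => n; apply: le_trans (hC n).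
rewrite le_eqVlt; apply/orP; left; apply/eqP; apply: eq_integral => w _.
by rewrite powRr1//; exact: rsum_ge0.
Qed.

Lemma expfun_lty_rlim (h : R) w : (0 < h)%R -> (rlim xi h w < +oo) = (expfun xi w < +oo).
Proof.
move=> h0; have /andP[lo hi] := expfun_rlim xiP h0 w.
apply/idP/idP => H; last exact: le_lt_trans H.
by apply: le_lt_trans hi _; rewrite lte_add_pinfty// ltry.
Qed.

Lemma expfun_ae_lty : {ae P, forall w, expfun xi w < +oo}.
Proof.
have := integrable_ae measurableT (rlim_integrable ltr01).
apply: filterS => w /(_ Logic.I) fin.
by rewrite -(expfun_lty_rlim w ltr01) ltey_eq fin.
Qed.

(** Right-continuity at 0 gives l > 0 with xi_l finite, and the first term l e^(-xi_l) of the
    Riemann sum of mesh l is a positive lower bound, for every path. *)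
Lemma expfun_gt0 w : 0 < expfun xi w.
Proof.
case: xiP => _ xi0 _ /(_ w 0%R (lexx _)) + _; rewrite xi0 => cxi.
have [l [l0 xil]] : exists l : R, (0 < l)%R /\ xi l w \is a fin_num.
  apply: (filter_ex (F := (0%R : R)^'+)); apply: filterI; first exact: nbhs_right_gt.
  exact: (cvg_is_fine (a := 0%R) cxi).
apply: (@lt_le_trans _ _ (rlim xi l w)); last by case/andP: (expfun_rlim xiP l0 w).
apply: (@lt_le_trans _ _ (rsum xi l 1 w)%:E).
  rewrite lte_fin /rsum /wsum big_ord1 mulr_gt0// /wstep mul1r.
  by case: (xi l w) xil => // r _; rewrite expN_EFin expR_gt0.
have nd : {homo (fun n => (rsum xi l n w)%:E) : n m / (n <= m)%N >-> n <= m}.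
  by move=> n m nm; rewrite lee_fin; exact: rsum_ndecr.
apply: lime_ge; first exact: is_cvg_rsum.
by exists 1%N => // n /= n1; exact: nd.
Qed.

(** Used with c = 0 and c = h, for the two sides of the moment identity. The power acts on [fine] of
    the limit, which is the true limit only almost everywhere. *)
Lemma monotone_powR (h p : R) (c : R) : (0 < h)%R -> (0 < p)%R -> (0 <= c)%R ->
  (\int[P]_w ((c + rsum xi h n w) `^ p)%:E) @[n --> \oo] -->
  \int[P]_w ((c + fine (rlim xi h w)) `^ p)%:E.
Proof.
move=> h0 p0 c0.
have mS n : measurable_fun [set: T] (fun w => ((c + rsum xi h n w) `^ p)%:E).
  apply/measurable_EFinP; apply: (measurableT_comp (measurable_powR p)).
  by apply: measurable_funD => //; exact: (measurable_rsum xiP h0).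
have Snd w : {homo (fun n => ((c + rsum xi h n w) `^ p)%:E) : n m / (n <= m)%N >-> n <= m}.
  move=> n m nm; rewrite lee_fin ge0_ler_powR ?(ltW p0) ?nnegrE ?addr_ge0 ?rsum_ge0//.
  by rewrite lerD2l; exact: rsum_ndecr.
rewrite [X in _ --> X](_ : _ = \int[P]_w limn (fun n => ((c + rsum xi h n w) `^ p)%:E)).
  apply: cvg_monotone_convergence => //.
  by move=> n w _; rewrite lee_fin powR_ge0.
apply: ae_eq_integral => //.
- apply/measurable_EFinP; apply: (measurableT_comp (measurable_powR p)).
  apply: measurable_funD => //; apply: measurableT_comp; first exact: fine_measurable.
  exact: (measurable_rlim xiP h0).
- apply: (emeasurable_fun_cvg (fun n w => ((c + rsum xi h n w) `^ p)%:E)) => // w _.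
  exact: ereal_nondecreasing_is_cvgn.
apply: filterS expfun_ae_lty => w; rewrite -(expfun_lty_rlim w h0) => fin _.
apply/esym/cvg_lim => //; apply: cvg_EFin; first by near=> n.
have /fineK E : rlim xi h w \is a fin_num.
  by rewrite ge0_fin_numE// (rlim_ge0 xi h0).
have cS : (fun n => rsum xi h n w) @ \oo --> fine (rlim xi h w).
  apply: (@fine_cvg _ _ _ _ (fun n => (rsum xi h n w)%:E)).
  by rewrite E; exact: (is_cvg_rsum h0).
apply: powR_cvg_nneg => //; last by apply: cvgD => //; exact: cvg_cst.
move=> n; rewrite addr_ge0 ?rsum_ge0//= lerD2l -(cvg_lim _ cS)//.
apply: nondecreasing_cvgn_le; first exact: rsum_ndecr.
by apply/cvg_ex; eexists; exact: cS.
Unshelve. all: by end_near. Qed.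

Lemma rlim_moment_lty (h p : R) : (0 < h)%R -> (0 < p)%R ->
  \int[P]_w (fine (rlim xi h w) `^ p)%:E < +oo.
Proof.
move=> h0 p0.
have [C hC] := rsum_moment_bound xiP h0 p0 (laplace (ltW h0) p0) (Phi_gt0 p0).
apply: (@le_lt_trans _ _ C%:E); last exact: ltry.
have := monotone_powR h0 p0 (lexx 0%R).
under [X in _ --> X]eq_integral do rewrite add0r.
move=> c; rewrite -(cvg_lim _ c)//; apply: lime_le.
  by apply/cvg_ex; eexists; exact: c.
by apply: nearW => n; under eq_integral do rewrite add0r.
Qed.

Lemma rlim_moment (h p : R) : (0 < h)%R -> (0 < p)%R ->
  \int[P]_w ((fine (rlim xi h w) + h) `^ p)%:E
    = (expR (h * Phi p))%:E * \int[P]_w (fine (rlim xi h w) `^ p)%:E.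
Proof.
move=> h0 p0.
have c1 := monotone_powR h0 p0 (ltW h0).
have c2 := monotone_powR h0 p0 (lexx 0%R).
(* The finite identity relates n steps to n + 1 steps; the shift disappears in the limit. *)
rewrite (_ : (fun n => _) = fun n => (expR (h * Phi p))%:E *
   \int[P]_w ((0 + rsum xi h n.+1 w) `^ p)%:E) in c1; last first.
  apply/funext => n; rewrite (rsum_moment xiP h0 p0 (laplace (ltW h0) p0)).
  by congr (_ * _); apply: eq_integral => w _; rewrite add0r.
have E : \int[P]_w ((0 + fine (rlim xi h w)) `^ p)%:E = \int[P]_w (fine (rlim xi h w) `^ p)%:E.
  by apply: eq_integral => w _; rewrite add0r.
have c3 : (expR (h * Phi p))%:E * \int[P]_w ((0 + rsum xi h n.+1 w) `^ p)%:E @[n --> \oo]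
    --> (expR (h * Phi p))%:E * \int[P]_w (fine (rlim xi h w) `^ p)%:E.
  apply: cvgeZl => //; rewrite -E.
  by rewrite (cvg_shiftS (fun n => \int[P]_w ((0 + rsum xi h n w) `^ p)%:E)).
rewrite -(cvg_unique _ c1 c3)//.
by apply: eq_integral => w _; rewrite addrC.
Qed.

End walk_limit.

Section expfun_moments.
Context {d : measure_display} {T : measurableType d} {R : realType}
  (P : probability T R) (xi : R -> T -> \bar R) (xiP : subordinator P xi)
  (Phi : R -> R).
Hypothesis laplace : forall l s : R, 0 <= l -> 0 < s ->
  (\int[P]_w expeR (- (s%:E * xi l w)))%E = (expR (- (l * Phi s)))%:E.
Hypothesis Phi_gt0 : forall s, 0 < s -> 0 < Phi s.
Local Open Scope ereal_scope.

Let I w := fine (expfun xi w).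
Let h (n : nat) : R := harmonic n.
Let D n w := fine (rlim xi (h n) w).

Let h0 n : (0 < h n)%R. Proof. exact: harmonic_gt0. Qed.

Let h1 n : (h n <= 1)%R.
Proof. by rewrite /h /= invf_le1 ?ltr0n// ler1n. Qed.

Let D_ge0 n w : (0 <= D n w)%R. Proof. exact/fine_ge0/rlim_ge0. Qed.

Let DI n w : (D n w <= I w <= D n w + h n)%R.
Proof.
have /andP[lo hi] := expfun_rlim xiP (h0 n) w.
have r0 := rlim_ge0 xi (h0 n) w; have x0 := le_trans r0 lo.
have := expfun_lty_rlim xiP w (h0 n); rewrite /D /I.
case: (rlim _ _ w) (expfun xi w) lo hi r0 x0 => [r||] [x||]//=.
- by rewrite -EFinD !lee_fin => -> ->.
(* Both values are infinite: [fine] sends them to 0 and the claim is 0 <= 0 <= h. *)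
- by move=> *; rewrite add0r lexx ltW.
Qed.

Let mD n : measurable_fun [set: T] (D n).
Proof.
by apply: measurableT_comp; [exact: fine_measurable|exact: (measurable_rlim xiP (h0 n))].
Qed.

Let DcvgI w : D ^~ w @ \oo --> I w.
Proof.
have lb : (fun n => I w - h n)%R @ \oo --> I w.
  by rewrite -[X in _ --> X]subr0; apply: cvgB; [exact: cvg_cst|exact: cvg_harmonic].
apply: (squeeze_cvgr _ lb (cvg_cst (I w))); near=> n.
by have /andP[-> ?] := DI n w; rewrite lerBlDr andbT.
Unshelve. all: by end_near. Qed.

Lemma measurable_expfun : measurable_fun [set: T] (expfun xi).
Proof.
apply: (emeasurable_fun_cvg (fun n => rlim xi (h n))).
  by move=> n; exact: (measurable_rlim xiP (h0 n)).
move=> w _; have x0 := ltW (expfun_gt0 xiP w).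
have [xoo|] := eqVneq (expfun xi w) +oo.
  rewrite xoo (_ : (fun n => _) = cst +oo); first exact: cvg_cst.
  apply/funext => n /=; apply/eqP; rewrite -leye_eq leNgt.
  by rewrite (expfun_lty_rlim xiP w (h0 n)) xoo ltxx.
rewrite -ltey => xlt.
rewrite -[X in _ --> X]fineK ?ge0_fin_numE//.
apply: cvg_EFin; last exact: DcvgI.
near=> n; rewrite ge0_fin_numE ?(rlim_ge0 xi (h0 n))//.
by rewrite (expfun_lty_rlim xiP w (h0 n)).
Unshelve. all: by end_near. Qed.

Lemma measurable_fine_expfun : measurable_fun [set: T] (fun w => fine (expfun xi w)).
Proof. by apply: measurableT_comp; [exact: fine_measurable|exact: measurable_expfun]. Qed.

Lemma fine_expfun_gt0 : {ae P, forall w, (0 < fine (expfun xi w))%R}.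
Proof.
apply: filterS (expfun_ae_lty xiP laplace Phi_gt0) => w xlt.
by apply: fine_gt0; rewrite (expfun_gt0 xiP).
Qed.

Let mpow p (f : T -> R) : measurable_fun [set: T] f ->
  measurable_fun [set: T] (fun w => (f w `^ p)%:E).
Proof.
by move=> mf; apply/measurable_EFinP; apply: (measurableT_comp (measurable_powR p)).
Qed.

(** The mesh of rank 0 is 1, so I <= D_0 + 1, and D_0 has all positive moments. *)
Lemma integrable_expfun p : (0 < p)%R ->
  P.-integrable [set: T] (fun w => (fine (expfun xi w) `^ p)%:E).
Proof.
move=> p0.
have iD : P.-integrable [set: T] (fun w => (D 0 w `^ p)%:E).
  apply/integrableP; split; first exact: mpow.
  rewrite (_ : \int[P]_w _ = \int[P]_w (D 0%N w `^ p)%:E).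
    exact: (rlim_moment_lty xiP laplace Phi_gt0 (h0 0) p0).
  by apply: eq_integral => w _; rewrite gee0_abs// lee_fin powR_ge0.
have iD1 : P.-integrable [set: T]
    (fun w => (2 `^ p)%:E * ((D 0%N w `^ p)%:E + (EFin \o cst (1 `^ p)%R) w)).
  apply: integrableZl => //; apply: integrableD => //.
  exact: finite_measure_integrable_cst.
apply: (le_integrable _ _ _ iD1) => //.
  by apply: mpow; exact: measurable_fine_expfun.
move=> w _ /=; rewrite lee_fin !ger0_norm ?powR_ge0//; last first.
  by rewrite mulr_ge0 ?addr_ge0 ?powR_ge0.
apply: le_trans (powRD_le (ltW p0) (D_ge0 0 w) ler01).
have /andP[lo hi] := DI 0 w.
rewrite ge0_ler_powR ?(ltW p0) ?nnegrE ?addr_ge0//.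
  exact: (le_trans (D_ge0 0 w)).
by apply: (le_trans hi); rewrite lerD2l.
Qed.

Lemma expfun_recursion p : (0 < p)%R ->
  P.-integrable [set: T] (fun w => (fine (expfun xi w) `^ (p - 1))%:E) /\
  p%:E * \int[P]_w (fine (expfun xi w) `^ (p - 1))%:E
    = (Phi p)%:E * \int[P]_w (fine (expfun xi w) `^ p)%:E.
Proof.
move=> p0; apply: (@moment_recursion _ _ _ P I D h) => //.
- by move=> n; rewrite h0 h1.
- exact: cvg_harmonic.
- exact: measurable_fine_expfun.
- by move=> n w; rewrite D_ge0; have /andP[] := DI n w.
- by move=> n w; have /andP[] := DI n w.
- exact: fine_expfun_gt0.
- exact: integrable_expfun.
- by move=> n; exact: (rlim_moment xiP laplace Phi_gt0 (h0 n) p0).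
Qed.

Lemma poweR_expfun p :
  \int[P]_w poweR (expfun xi w) p = \int[P]_w (fine (expfun xi w) `^ p)%:E.
Proof.
apply: ae_eq_integral => //.
- apply: (measurableT_comp (measurable_poweR p)); exact: measurable_expfun.
- by apply: mpow; exact: measurable_fine_expfun.
apply: filterS (expfun_ae_lty xiP laplace Phi_gt0) => w xlt _.
by rewrite -{1}(@fineK _ (expfun xi w))// ge0_fin_numE// ltW// (expfun_gt0 xiP).
Qed.

End expfun_moments.

(** * Euler's Gamma function *)

Section Gamma_function.
Context {R : realType}.
Local Notation mu := (@lebesgue_measure R).

(** The segments [1/(n + 1), n + 2] exhaust ]0, +oo[; the offset 2 keeps a_0 = 1 below b_0. *)
Let a (n : nat) : R := n.+1%:R^-1.
Let b (n : nat) : R := n.+2%:R.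

Let a_gt0 n : 0 < a n. Proof. by rewrite invr_gt0 ltr0n. Qed.

Let ab n : a n < b n.
Proof.
apply: (@le_lt_trans _ _ 1); last by rewrite ltr1n.
by rewrite invf_le1 ?ltr0n// ler1n.
Qed.

Let bigcup_ab : \bigcup_n `[a n, b n]%classic = `]0%R, +oo[%classic.
Proof.
apply/seteqP; split=> x /=.
  move=> [n _]; rewrite /= !in_itv/= andbT => /andP[+ _].
  exact: lt_le_trans.
rewrite in_itv/= andbT => x0.
exists (maxn (Num.truncn x) (Num.truncn x^-1)) => //=; rewrite in_itv/=; apply/andP; split.
  rewrite -[leRHS]invrK /a lef_pV2 ?posrE ?ltr0n ?invr_gt0//.
  by apply/ltW/(lt_le_trans (truncnS_gt _)); rewrite ler_nat ltnS leq_maxr.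
apply/ltW/(lt_le_trans (truncnS_gt _)); rewrite ler_nat ltnS.
by apply: leq_trans (leqnSn _); exact: leq_maxl.
Qed.

Let gint (r t : R) : R := t `^ (r - 1) * expR (- t).

Let gint_ge0 r t : 0 <= gint r t.
Proof. by rewrite mulr_ge0 ?powR_ge0// expR_ge0. Qed.

Let continuous_gint r x : 0 < x -> {for x, continuous (gint r)}.
Proof.
move=> x0; apply: continuousM; first exact: powR_continuous_gt0.
apply: (@continuous_comp _ _ _ (fun x : R => - x) (@expR R)).
  exact: opp_continuous.
exact: continuous_expR.
Qed.

Lemma measurable_gint r : measurable_fun [set: R] (gint r).
Proof.
apply: measurable_funM; first exact: measurable_powR.
apply: measurableT_comp; first exact: measurable_expR.
by [].
Qed.

Let gint_within r n : {within `[a n, b n], continuous (gint r)}.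
Proof.
apply: continuous_in_subspaceT => x; rewrite inE/= in_itv/= => /andP[ax _].
by apply: continuous_gint; exact: lt_le_trans ax.
Qed.

Let is_derive_gint (r x : R) : 0 < x ->
  is_derive x 1 (gint (r + 1)) (r * gint r x - gint (r + 1) x).
Proof.
move=> x0.
have d1 := is_derive1_powR (r + 1 - 1) x0.
have d2 : is_derive x 1 (fun x => expR (- x)) (- expR (- x)).
  by apply: is_derive_eq => /=; rewrite mulrN1.
have D : is_derive x 1 (gint (r + 1)) _ := is_deriveM d1 d2.
apply: (is_derive_eq D).
rewrite /gint /= addrK; rewrite /GRing.scale /=; ring.
Qed.

(** Integration by parts, as the fundamental theorem for t^r e^(-t). On a segment every integral is
    finite, so terms may be moved across. *)
Let gint_itv (r : R) n :
  (\int[mu]_(t in `[a n, b n]) (gint (r + 1) t)%:E =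
   r%:E * \int[mu]_(t in `[a n, b n]) (gint r t)%:E
   + (gint (r + 1) (a n) - gint (r + 1) (b n))%:E)%E.
Proof.
have ii s : mu.-integrable `[a n, b n] (EFin \o gint s).
  by apply: continuous_compact_integrable; [exact: segment_compact|exact: gint_within].
have iF s : (\int[mu]_(t in `[a n, b n]) (gint s t)%:E)%E \is a fin_num.
  by apply: integrable_fin_num (ii s).
have : (\int[mu]_(t in `[a n, b n]) (r * gint r t - gint (r + 1) t)%:E =
   (gint (r + 1) (b n))%:E - (gint (r + 1) (a n))%:E)%E.
  apply: continuous_FTC2 (ab n) _ _ _.
  - apply: continuous_in_subspaceT => x; rewrite inE/= in_itv/= => /andP[ax _].
    have x0 : 0 < x by exact: lt_le_trans ax.
    by apply: cvgB; [apply: cvgM; [exact: cvg_cst|]|]; exact: continuous_gint.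
  - split.
    + move=> x; rewrite in_itv/= => /andP[ax _].
      by case: (is_derive_gint r (lt_trans (a_gt0 n) ax)).
    + by apply: cvg_at_right_filter; exact: continuous_gint.
    + apply: cvg_at_left_filter; apply: continuous_gint.
      exact: lt_trans (ab n).
  - move=> x; rewrite in_itv/= => /andP[ax _]; rewrite derive1E.
    by case: (is_derive_gint r (lt_trans (a_gt0 n) ax)).
rewrite (_ : (\int[mu]_(t in `[a n, b n]) _)%E =
    (r%:E * \int[mu]_(t in `[a n, b n]) (gint r t)%:E -
     \int[mu]_(t in `[a n, b n]) (gint (r + 1) t)%:E)%E).
  rewrite -(fineK (iF r)) -(fineK (iF (r + 1))) -EFinM -!EFinB => -[E].
  congr (_%:E); lra.
under eq_integral do rewrite EFinB EFinM.
rewrite integralB//; first last.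
  - exact: (ii (r + 1)).
  - by apply: integrableZl => //; exact: (ii r).
by rewrite integralZl//; exact: (ii r).
Qed.

Let cvg_gint_itv r : (\int[mu]_(t in `[a n, b n]) (gint r t)%:E)%E @[n --> \oo] --> Gammaf r.
Proof.
rewrite /Gammaf -bigcup_ab.
apply: ge0_nondecreasing_set_cvg_integral.
- apply/nondecreasing_seqP => n; apply/subsetPset => x /=.
  rewrite !in_itv/= => /andP[ax xb]; apply/andP; split.
    by apply: le_trans ax; rewrite /a lef_pV2 ?posrE ?ltr0n// ler_nat.
  by apply: (le_trans xb); rewrite ler_nat.
- by move=> n; exact: measurable_itv.
- move=> n; apply/measurable_EFinP; exact: measurable_funS (measurable_gint r).
- by move=> n x _; rewrite lee_fin gint_ge0.
Qed.

Let cvg_gint_a (r : R) : 0 < r -> gint (r + 1) (a n) @[n --> \oo] --> (0 : R).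
Proof.
move=> r0.
have ub : (a n `^ r) @[n --> \oo] --> (0 : R).
  have /cvg_at_rightP := powR_cvg0 r0; apply; split=> //; exact: cvg_harmonic.
apply: (squeeze_cvgr _ (cvg_cst 0) ub); near=> n.
rewrite gint_ge0/= /gint addrK ler_piMr ?powR_ge0//.
by rewrite -expR0 ler_expR oppr_le0 ltW.
Unshelve. all: by end_near. Qed.

(** With an integer m >= r, t^r <= t^m for t >= 1 and e^t >= t^(m+1)/(m+1)!, so the boundary term is
    at most (m+1)!/t. *)
Let cvg_gint_b (r : R) : 0 < r -> gint (r + 1) (b n) @[n --> \oo] --> (0 : R).
Proof.
move=> r0.
pose m := (Num.truncn r).+1.
have rm : r <= m%:R by exact/ltW/truncnS_gt.
have ub : (m.+1`!%:R * n.+1%:R^-1 : R) @[n --> \oo] --> (0 : R).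
  rewrite -[X in _ --> X](mulr0 (m.+1`!%:R)); apply: cvgM; first exact: cvg_cst.
  exact: cvg_harmonic.
apply: (squeeze_cvgr _ (cvg_cst 0) ub); near=> n.
rewrite gint_ge0/= /gint addrK.
have b1 : 1 <= b n by rewrite ler1n.
have b0 : 0 < b n by apply: lt_le_trans b1.
apply: (@le_trans _ _ (b n ^+ m * expR (- b n))).
  by rewrite ler_wpM2r ?expR_ge0// -powR_mulrn ?(ltW b0)// ler_powR.
have H : b n ^+ m.+1 / m.+1`!%:R <= expR (b n).
  by apply: le_trans (expR_ge1Dxn m (ltW b0)); rewrite lerDr.
have f0 : 0 < m.+1`!%:R :> R by rewrite ltr0n fact_gt0.
rewrite ler_pdivrMr// exprS in H.
rewrite expRN ler_pdivrMr ?expR_gt0// mulrAC ler_pdivlMr ?ltr0n//.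
apply: (@le_trans _ _ (b n * b n ^+ m)); last by rewrite [leRHS]mulrC.
rewrite mulrC ler_wpM2r ?exprn_ge0 ?(ltW b0)// ler_nat.
exact: leqnSn.
Unshelve. all: by end_near. Qed.

(** Stated in the extended reals, hence available before finiteness, which it helps to prove. *)
Lemma Gamma_recursion (r : R) : 0 < r -> (Gammaf (r + 1) = r%:E * Gammaf r)%E.
Proof.
move=> r0.
have c1 := @cvg_gint_itv (r + 1).
have c2 : (\int[mu]_(t in `[a n, b n]) (gint (r + 1) t)%:E)%E @[n --> \oo]
    --> (r%:E * Gammaf r)%E.
  rewrite -[X in _ --> X]adde0; under eq_cvg do rewrite gint_itv.
  apply: cvgeD; first by rewrite fin_num_adde_defl.
    by apply: cvgeZl => //; exact: cvg_gint_itv.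
  apply: cvg_EFin; first exact: nearW.
  by rewrite -[X in _ --> X](subr0 0); apply: cvgB; [exact: cvg_gint_a|exact: cvg_gint_b].
exact: (cvg_unique _ c1 c2).
Qed.

Lemma Gamma1 : Gammaf (1 : R) = 1%E.
Proof.
have ce : continuous (fun x : R => expR (- x)).
  move=> x; apply: (@continuous_comp _ _ _ (fun x : R => - x) (@expR R)).
    exact: opp_continuous.
  exact: continuous_expR.
have de (x : R) : is_derive x 1 (fun x : R => - expR (- x)) (expR (- x)).
  by apply: is_derive_eq => /=; rewrite mulrN1 opprK.
rewrite /Gammaf.
transitivity (\int[mu]_(t in `]0%R, +oo[) (expR (- t))%:E)%E.
  by apply: eq_integral => t _; rewrite subrr powRr0 mul1r.
rewrite integral_itv_obnd_cbnd; last first.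
  apply/measurable_EFinP; apply: measurable_funTS.
  by apply: measurableT_comp; first exact: measurable_expR.
rewrite (@ge0_continuous_FTC2y R (fun x => expR (- x)) (fun x => - expR (- x)) 0 0).
- by rewrite sub0e -EFinN opprK oppr0 expR0.
- by move=> x _; exact: expR_ge0.
- by apply: continuous_subspaceT => x; exact: ce.
- by rewrite -[X in _ --> X]oppr0; apply: cvgN; exact: cvgr_expR.
- by move=> x _; case: (de x).
- by apply: cvg_at_right_filter; apply: cvgN; exact: ce.
- by move=> x _; rewrite derive1E; case: (de x).
Qed.

Lemma Gamma_ge0 (r : R) : (0 <= Gammaf r)%E.
Proof. by apply: integral_ge0 => t _; rewrite lee_fin gint_ge0. Qed.

Let mG r : measurable_fun (`]0, +oo[%classic : set R) (fun t => (gint r t)%:E).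
Proof. by apply/measurable_EFinP; apply: measurable_funTS; exact: measurable_gint. Qed.

(** For 1 <= s <= 2, t^(s-1) <= 1 + t bounds the integral by Gamma(1) + Gamma(2); the recursion
    carries finiteness down to ]0, 1[ and up past 2. *)
Lemma Gamma_lty (r : R) : 0 < r -> (Gammaf r < +oo)%E.
Proof.
have H (s : R) : 1 <= s <= 2 -> (Gammaf s < +oo)%E.
  move=> /andP[s1 s2].
  apply: (@le_lt_trans _ _ (Gammaf (1 : R) + Gammaf (1 + 1))%E); last first.
    by rewrite Gamma_recursion// Gamma1 mule1 -EFinD ltry.
  rewrite /Gammaf -ge0_integralD//=; try by [exact: mG|move=> t _; rewrite lee_fin gint_ge0].
  apply: ge0_le_integral => //; try exact: mG.
  - by move=> t _; rewrite lee_fin gint_ge0.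
  - by apply: emeasurable_funD; exact: mG.
  move=> t; rewrite /= in_itv/= andbT => t0; rewrite -EFinD lee_fin -mulrDl.
  rewrite ler_pM2r ?expR_gt0// subrr addrK powRr0 powRr1 ?(ltW t0)//.
  have [t1|/ltW t1] := leP 1 t.
    apply: (@le_trans _ _ (t `^ 1)); first by rewrite ler_powR//; lra.
    by rewrite powRr1 ?lerDr// ltW.
  apply: (@le_trans _ _ 1); last by rewrite lerDl ltW.
  by rewrite -[leRHS](powRr0 t) ger_powR ?t0//; lra.
move=> r0; have [n] := ubnP (Num.truncn r).
elim: n r r0 => // n IH r r0.
have [r1|r1] := leP 1 r; last first.
  move=> _; have : (Gammaf (r + 1) < +oo)%E by apply: H; lra.
  rewrite Gamma_recursion// !ltey; apply: contra => /eqP ->.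
  by rewrite gt0_muley ?lte_fin.
have [r2 _|r2 rn] := leP r 2; first by apply: H; rewrite r1.
rewrite -(subrK 1 r) Gamma_recursion; last by lra.
rewrite lte_mul_pinfty ?lee_fin//; first by lra.
apply: IH; first by lra.
rewrite truncn_lt_nat; last by lra.
move: rn; rewrite truncn_lt_nat; last by lra.
by rewrite -[n.+1%:R]natr1; lra.
Qed.

Lemma Gamma_gt0 (r : R) : 1 <= r -> (0 < Gammaf r)%E.
Proof.
move=> r1; apply: (@lt_le_trans _ _ (\int[mu]_(t in `]1%R, 2%R]) (cst (expR (- 2))%:E t))%E).
  have m12 : mu `]1%R, 2%R]%classic = 1%E.
    by rewrite lebesgue_measure_itv/= lte_fin ltr1n -EFinB; congr (_%:E); lra.
  rewrite integral_cst//; apply: mule_gt0; first by rewrite lte_fin expR_gt0.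
  by apply: (@lt_le_trans _ _ 1%E) => //; rewrite le_eqVlt; apply/orP; left; apply/eqP/esym; exact: m12.
apply: (@le_trans _ _ (\int[mu]_(t in `]1%R, 2%R]) (gint r t)%:E)%E).
  apply: ge0_le_integral => //.
  - by move=> t _; rewrite lee_fin expR_ge0.
  - by apply/measurable_EFinP; apply: measurable_funTS; exact: measurable_gint.
  move=> t; rewrite /= in_itv/= => /andP[t1 t2]; rewrite lee_fin.
  apply: (@le_trans _ _ (1 * expR (- t))); first by rewrite mul1r ler_expR lerN2.
  rewrite ler_pM2r ?expR_gt0// -[leLHS](powRr0 t) ler_powR ?(ltW t1)//; lra.
apply: ge0_subset_integral => //; first exact: mG.
- by move=> t _; rewrite lee_fin gint_ge0.
- by move=> t /=; rewrite !in_itv/= andbT => /andP[t1 _]; apply: lt_trans t1.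
Qed.

End Gamma_function.

Section Gamma_log_convexity.
Context {R : realType}.

Lemma Gamma_log_convex (a b t : R) : 1 <= a -> 1 <= b -> 0 < t < 1 ->
  fine (Gammaf ((1 - t) * a + t * b)) <= fine (Gammaf a) `^ (1 - t) * fine (Gammaf b) `^ t.
Proof.
move=> a1 b1 t01; have /andP[t0 t1] := t01.
have a0 : 0 < a by lra.
have b0 : 0 < b by lra.
pose D : set R := `]0, +oo[%classic.
have mD : measurable D by exact: measurable_itv.
pose g r (x : R) := x `^ (r - 1) * expR (- x).
have g0 r x : 0 <= g r x by rewrite mulr_ge0 ?powR_ge0 ?expR_ge0.
have ig r : 0 < r -> lebesgue_measure.-integrable D (EFin \o g r).
  move=> r0; apply/integrableP; split.
    by apply/measurable_EFinP; apply: measurable_funTS; exact: measurable_gint.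
  apply: le_lt_trans (Gamma_lty r0); rewrite le_eqVlt; apply/orP; left; apply/eqP.
  by apply: eq_integral => x _; rewrite gee0_abs// lee_fin.
have pos r : 1 <= r -> 0 < \int[lebesgue_measure]_(x in D) g r x.
  move=> r1; apply: fine_gt0; rewrite Gamma_gt0//=.
  by apply: Gamma_lty; apply: lt_le_trans r1.
have [_] := @Rintegral_log_convex _ _ _ lebesgue_measure D mD (g a) (g b) t t01
  (fun x _ => g0 a x) (fun x _ => g0 b x) (ig a a0) (ig b b0) (pos a a1) (pos b b1).
apply: le_trans; rewrite le_eqVlt; apply/orP; left; apply/eqP.
apply: eq_Rintegral => x; rewrite inE /D /= in_itv/= andbT => x0.
rewrite /g !powRM ?powR_ge0 ?expR_ge0// -!powRrM -!expRM.
have -> : (1 - t) * a + t * b - 1 = (a - 1) * (1 - t) + (b - 1) * t by ring.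
rewrite powRD; last by rewrite (gt_eqF x0) implybT.
have -> : expR (- x) = expR (- x * (1 - t)) * expR (- x * t).
  by rewrite -expRD; congr expR; ring.
ring.
Qed.
End Gamma_log_convexity.

(** * The Laplace exponent and the measure kappa *)

Section Laplace_exponent.
Context {d : measure_display} {T : measurableType d} {R : realType}
  (P : probability T R) (Y : T -> R) (Phi : R -> R).
Hypothesis mY : measurable_fun [set: T] Y.
Hypothesis Y01 : forall w, 0 <= Y w <= 1.
Hypothesis laplaceY : forall s : R, 0 < s ->
  (\int[P]_w (Y w `^ s)%:E)%E = (expR (- Phi s))%:E.

Let mYs s : measurable_fun [set: T] (fun w => (Y w `^ s)%:E).
Proof. by apply/measurable_EFinP; exact: (measurableT_comp (measurable_powR s) mY). Qed.

Let Y_ge0 w : 0 <= Y w. Proof. by case/andP: (Y01 w). Qed.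

Lemma Laplace_exponent_ge0 s : 0 < s -> 0 <= Phi s.
Proof.
move=> s0; rewrite -oppr_le0 -ler_expR expR0 -lee_fin -laplaceY//.
apply: (@le_trans _ _ (\int[P]_w cst 1%E w)%E).
  apply: ge0_le_integral => //.
  - by move=> w _; rewrite lee_fin powR_ge0.
  - move=> w _; rewrite lee_fin; apply: (@le_trans _ _ (1 `^ s)); last by rewrite powR1.
    by rewrite ge0_ler_powR ?nnegrE ?(ltW s0)//; case/andP: (Y01 w).
by rewrite integral_cst// mul1e; exact: probability_le1.
Qed.

Lemma Laplace_exponent_ndecr s t : 0 < s -> s <= t -> Phi s <= Phi t.
Proof.
move=> s0 st; have t0 := lt_le_trans s0 st.
rewrite -lerN2 -ler_expR -lee_fin -!laplaceY//.
apply: ge0_le_integral => //.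
- by move=> w _; rewrite lee_fin powR_ge0.
- move=> w _; rewrite lee_fin; have /andP[y0 y1] := Y01 w.
  have [->|yn] := eqVneq (Y w) 0; first by rewrite !powR0 ?gt_eqF.
  by rewrite ger_powR// lt_def yn y0.
Qed.

Let iYs s : 0 < s -> P.-integrable [set: T] (EFin \o (fun w => Y w `^ s)).
Proof.
move=> s0; apply/integrableP; split; first exact: mYs.
rewrite (_ : (\int[P]_w _ = \int[P]_w (Y w `^ s)%:E)%E); first by rewrite laplaceY// ltry.
by apply: eq_integral => w _; rewrite gee0_abs// lee_fin powR_ge0.
Qed.

(** Cauchy-Schwarz against the constant 1: E[Y^s] <= E[Y^(2s)]^(1/2). *)
Lemma Laplace_exponent_double s : 0 < s -> Phi (2 * s) <= 2 * Phi s.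
Proof.
move=> s0; have s20 : 0 < 2 * s by rewrite mulr_gt0.
have laplaceR t : 0 < t -> \int[P]_w (Y w `^ t) = expR (- Phi t).
  by move=> t0; rewrite /Rintegral laplaceY.
have i1 : \int[P]_w (cst 1 w) = 1 :> R.
  rewrite Rintegral_cst// mul1r -[RHS]/(fine 1%E); congr fine.
  exact: probability_setT.
have half : 0 < (2^-1 : R) < 1 by rewrite invr_gt0 ltr0n invf_lt1 ?ltr1n.
have := @Rintegral_log_convex _ _ _ P setT measurableT (cst 1) (fun w => Y w `^ (2 * s)) 2^-1 half.
rewrite i1 laplaceR// powR1 mul1r => /(_ _ _ _ _ _ _).
case=> //.
- by move=> w _; exact: powR_ge0.
- exact: finite_measure_integrable_cst.
- exact: iYs.
- exact: expR_gt0.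
move=> _.
rewrite (_ : (\int[P]_x _)%R = expR (- Phi s)); last first.
  rewrite -laplaceR//; apply: eq_Rintegral => w _ /=.
  rewrite ?powR1 mul1r -powRrM; congr (_ `^ _).
  by rewrite mulrAC mulfV ?mul1r// pnatr_eq0.
rewrite -expRM ler_expR; lra.
Qed.

Hypothesis Phi_neq0 : exists s, 0 < s /\ Phi s != 0.

(** A zero at s spreads to every 2^n s by doubling, then to all smaller points by monotonicity,
    against [Phi_neq0]. *)
Lemma Laplace_exponent_gt0 s : 0 < s -> 0 < Phi s.
Proof.
move=> s0; rewrite lt_def Laplace_exponent_ge0// andbT; apply/eqP => Ps0.
have [t [t0 /eqP]] := Phi_neq0; apply.
have P2 n : Phi (2 ^+ n * s) = 0.
  elim: n => [|n IH]; first by rewrite expr0 mul1r.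
  have p0 : 0 < 2 ^+ n * s by rewrite mulr_gt0 ?exprn_gt0.
  apply/eqP; rewrite eq_le Laplace_exponent_ge0 ?mulr_gt0 ?exprn_gt0// andbT.
  by rewrite exprS -mulrA (le_trans (Laplace_exponent_double p0))// IH mulr0.
apply/eqP; rewrite eq_le Laplace_exponent_ge0// andbT.
rewrite -(P2 (Num.truncn (t / s)).+1); apply: Laplace_exponent_ndecr => //.
rewrite -ler_pdivrMr//; apply: ltW; apply: lt_trans (truncnS_gt _) _.
by rewrite -natrX ltr_nat ltn_expl.
Qed.

(** Differentiation of E[Y^t] under the integral, on the event Y > 0 where Y^t = e^(t ln Y);
    elsewhere Y^t = 0. It gives [derive1 Phi], through which kappa is specified, its meaning as a
    derivative. *)
Lemma Laplace_exponent_derivable s : 0 < s -> derivable Phi s 1.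
Proof.
move=> s0.
pose B := [set w | 0 < Y w].
have mB : measurable B.
  rewrite (_ : B = Y @^-1` `]0, +oo[).
    by rewrite -[X in measurable X]setTI; exact: mY.
  by apply/seteqP; split=> w /=; rewrite in_itv/= andbT.
pose f (t : R) w := expR (t * ln (Y w)).
have fE t w : B w -> f t w = Y w `^ t.
  by move=> Bw; rewrite /powR gt_eqF.
have LB t : 0 < t -> \int[P]_(w in B) f t w = expR (- Phi t).
  move=> t0; rewrite /Rintegral -[RHS]/(fine (expR (- Phi t))%:E) -laplaceY//; congr fine.
  rewrite integral_mkcond; apply: eq_integral => w _; rewrite patchE.
  case: ifPn => [/set_mem Bw|]; first by rewrite fE.
  rewrite notin_setE /B /= => /negP; rewrite -leNgt => Yle.
  by rewrite (_ : Y w = 0) ?powR0 ?gt_eqF//; apply/eqP; rewrite eq_le Yle Y_ge0.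
pose c := s / 2.
have c0 : 0 < c by rewrite divr_gt0.
have fder (t : R) w : is_derive t 1 (f^~ w) (ln (Y w) * f t w).
  have dm : is_derive t 1 (fun t : R => t * ln (Y w)) (ln (Y w)).
    by apply: is_derive_eq; rewrite /GRing.scale/= mulr0 add0r mulr1.
  have D := @is_derive1_comp R (@expR R) (fun t => t * ln (Y w)) t _ _ (is_derive_expR _) dm.
  by apply: (is_derive_eq D); rewrite mulrC.
have dint : derivable (fun t => \int[P]_(w in B) f t w) s 1.
  apply: (@derivable_under_integral _ _ _ P f B mB s c (2 * s) _ _ _ (cst c^-1)).
  - by rewrite /= in_itv/= /c ltr_pdivrMr//; apply/andP; split; lra.
  - move=> t; rewrite /= in_itv/= => /andP[ct _].
    have t0 := lt_trans c0 ct.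
    apply: eq_integrable (integrableS measurableT mB (@subsetT _ _) (iYs t0)) => //.
    by move=> w /set_mem Bw /=; rewrite fE.
  - by move=> t w _ _; case: (fder t w).
  - by move=> w; rewrite /= invr_ge0 ltW.
  - exact: finite_measure_integrable_cst.
  (* With u = -ln Y >= 0 and t > c = s/2, u e^(-tu) <= u e^(-cu) <= 1/c, because cu <= e^(cu). *)
  move=> t w; rewrite /= in_itv/= => /andP[ct _] Bw.
  rewrite partial1of2E (@derive_val _ _ _ _ _ _ _ (fder t w)) /f /=.
  have /andP[_ Y1] := Y01 w.
  have l0 : ln (Y w) <= 0 by exact: ln_le0.
  rewrite normrM (ger0_norm (expR_ge0 _)) ler0_norm// -ler_pdivlMr ?expR_gt0// -expRN.
  apply: (@le_trans _ _ (c^-1 * expR (c * - ln (Y w)))).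
    rewrite mulrC ler_pdivlMr// mulrC; apply: le_trans (expR_ge1Dx _).
    by rewrite lerDr.
  rewrite ler_pM2l ?invr_gt0// ler_expR -mulrN ler_wpM2r// ?oppr_ge0//.
  exact: ltW.
have Lgt0 : 0 < \int[P]_(w in B) f s w by rewrite LB// expR_gt0.
have dln : derivable (fun t => - ln (\int[P]_(w in B) f t w)) s 1.
  apply: derivableN.
  have dL : is_derive s 1 (fun t => \int[P]_(w in B) f t w)
      ('D_1 (fun t => \int[P]_(w in B) f t w) s) by exact: DeriveDef.
  by case: (@is_derive1_comp R (@ln R) _ s _ _ (is_derive1_ln Lgt0) dL).
apply: near_eq_derivable dln.
near=> t.
have t0 : 0 < t by near: t; exact: lt_nbhsr.
by rewrite LB// expRK opprK.
Unshelve. all: by end_near. Qed.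

End Laplace_exponent.

(** * Pointwise identities and bounds for the integrand *)

Section kint_pointwise.
Context {R : realType}.
Implicit Types r x w a b : R.

(** The Frullani integrand: for x > 0, the integral of e^(-tx) over t from a to b. *)
Definition qexp a b x : R := (expR (- (a * x)) - expR (- (b * x))) / x.

Lemma qexp_bounds a b x : 0 < x -> 0 < a -> a <= b ->
  (b - a) * expR (- (b * x)) <= qexp a b x <= (b - a) * expR (- (a * x)).
Proof.
move=> x0 a0 ab; rewrite /qexp ler_pdivlMr// ler_pdivrMr//.
have -> : - (b * x) = - (a * x) + - ((b - a) * x) by ring.
rewrite expRD; have e1 := expR_gt0 (- (a * x)); have := expR_ge1Dx (- ((b - a) * x)).
have := expR_ge1Dx ((b - a) * x).
have e2 : expR ((b - a) * x) * expR (- ((b - a) * x)) = 1.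
  by rewrite -expRD subrr expR0.
have e3 := expR_gt0 (- ((b - a) * x)).
set u := expR (- (a * x)) in e1 *; set v := expR (- ((b - a) * x)) in e2 e3 *.
set z := (b - a) * x in e2 *; set y := expR z in e2 *.
move=> H1 H2.
have H3 : (1 + z) * v <= 1 by rewrite -[leRHS]e2 ler_pM2r.
have -> : (b - a) * (u * v) * x = u * (z * v) by rewrite /z; ring.
have -> : (b - a) * u * x = u * z by rewrite /z; ring.
have -> : u - u * v = u * (1 - v) by ring.
rewrite !ler_pM2l//; apply/andP; split; lra.
Qed.

Lemma qexpD a b c x : qexp a c x = qexp a b x + qexp b c x.
Proof. by rewrite /qexp -mulrDl; congr (_ / _); ring. Qed.

Let kden x : 0 < x -> 0 < x * (expR x - 1).
Proof. by move=> x0; rewrite mulr_gt0// subr_gt0 expR_gt1. Qed.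

Lemma kint_succ r x : 0 < x -> kint (r + 1) x = kint r x + qexp 1 r x.
Proof.
move=> x0; rewrite /kint /qexp addrK.
have E1 : expR x - 1 != 0 by rewrite gt_eqF// subr_gt0 expR_gt1.
have E0 := expR_gt0 x.
have -> : expR (- ((r - 1) * x)) = expR (- (r * x)) * expR x.
  by rewrite -expRD; congr expR; ring.
have -> : expR (- x) = (expR x)^-1 by rewrite expRN.
have -> : expR (- (1 * x)) = (expR x)^-1 by rewrite mul1r expRN.
by field; rewrite E1 !gt_eqF.
Qed.

(** Isolates what becomes negligible: the first two terms have integrals that the recursion and
    Frullani's formula control, and the last carries the factor e^(-nx). *)
Lemma kint_tail n w x : 0 < x ->
  kint (n + 1 + w) x = kint (n + 1) x + w * qexp 1 (n + 1) x
     + expR (- (n * x)) * kint (1 + w) x.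
Proof.
move=> x0; rewrite /kint /qexp.
have -> : n + 1 + w - 1 = n + w by ring.
have -> : n + 1 - 1 = n by ring.
have -> : 1 + w - 1 = w by ring.
have E1 : expR x - 1 != 0 by rewrite gt_eqF// subr_gt0 expR_gt1.
have E0 := expR_gt0 x.
have -> : expR (- ((n + w) * x)) = expR (- (n * x)) * expR (- (w * x)).
  by rewrite -expRD; congr expR; ring.
have -> : expR (- ((n + 1) * x)) = expR (- (n * x)) * (expR x)^-1.
  by rewrite -expRN -expRD; congr expR; ring.
have -> : expR (- x) = (expR x)^-1 by rewrite expRN.
have -> : expR (- (1 * x)) = (expR x)^-1 by rewrite mul1r expRN.
by field; rewrite E1 !gt_eqF.
Qed.

(** Upper bound: convexity, e^(-wx) <= 1 - w + w e^(-x). Lower bound: e^(-wx) >= 1 - wx together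
    with e^(-x) (1 + x) <= 1. *)
Lemma kint_bounds w x : 0 < x -> 0 < w <= 1 ->
  - (w * expR (- x)) <= kint (1 + w) x <= 0.
Proof.
move=> x0 /andP[w0 w1]; rewrite /kint.
have -> : 1 + w - 1 = w by ring.
rewrite ler_pdivlMr ?kden// ler_pdivrMr ?kden// mul0r.
have e0 := expR_gt0 x; have em0 := expR_gt0 (- x).
have em : expR (- x) * expR x = 1 by rewrite -expRD addNr expR0.
have H1 := expR_ge1Dx (- (w * x)).
have H2 := expR_ge1Dx x.
have H3 : expR (- (w * x)) <= 1 + w * (expR (- x) - 1).
  have [->|wn] := eqVneq w 1; first by rewrite !mul1r; lra.
  have w01 : 0 < w < 1 by rewrite w0 lt_neqAle wn.
  have := powR_young (x := 1) (y := expR (- x)) ler01 (expR_ge0 _) w01.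
  rewrite powR1 mul1r mulr1 -expRM [- x * w]mulNr [x * w]mulrC; lra.
apply/andP; split; last lra.
have H4 : expR (- x) * (1 + x) <= 1 by rewrite -[leRHS]em ler_pM2l.
have -> : - (w * expR (- x)) * (x * (expR x - 1)) =
    - (w * (x * (expR (- x) * expR x) - x * expR (- x))) by ring.
rewrite em; nra.
Qed.

Lemma measurable_fun_div_pos (D : set R) (f g : R -> R) :
  (forall x, D x -> 0 < g x) -> measurable_fun [set: R] f -> measurable_fun [set: R] g ->
  measurable_fun D (fun x => f x / g x).
Proof.
move=> g0 mf mg; apply: (@eq_measurable_fun _ _ R R _ (fun x => f x * g x `^ (- 1))).
  by move=> x; rewrite inE => Dx; rewrite powR_inv1// ltW// g0.
apply: measurable_funTS; apply: measurable_funM => //.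
exact: (measurableT_comp (measurable_powR (-1))).
Qed.

Lemma measurable_kint r : measurable_fun (`]0, +oo[%classic : set R) (kint r).
Proof.
have mexp c : measurable_fun [set: R] (fun x : R => expR (- (c * x))).
  by apply: measurableT_comp; [exact: measurable_expR|apply: measurableT_comp].
apply: measurable_fun_div_pos.
- by move=> x; rewrite /= in_itv/= andbT; exact: kden.
- apply: measurable_funB; first by apply: measurable_funB => //; exact: mexp.
  apply: measurable_funM => //; apply: measurable_funB => //.
  by apply: measurableT_comp; [exact: measurable_expR|].
- apply: measurable_funM => //.
  by apply: measurable_funB => //; exact: measurable_expR.
Qed.

Lemma measurable_qexp a b : measurable_fun (`]0, +oo[%classic : set R) (qexp a b).
Proof.
have mexp c : measurable_fun [set: R] (fun x : R => expR (- (c * x))).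
  by apply: measurableT_comp; [exact: measurable_expR|apply: measurableT_comp].
apply: measurable_fun_div_pos => //; first by move=> x; rewrite /= in_itv/= andbT.
by apply: measurable_funB; exact: mexp.
Qed.
End kint_pointwise.

(** Cut [a, b] into n + 1 equal steps: the differences of K telescope and the step length gives a
    factor 1/(n + 1). So two functions whose increments over each [a, b] lie between (b - a) K b and
    (b - a) K a differ by a constant. *)
Lemma eq_of_increment_bound (R : realType) (f K : R -> R) :
  (forall a b, 0 < a -> a <= b -> `|f b - f a| <= (b - a) * (K a - K b)) ->
  forall a b, 0 < a -> a <= b -> f a = f b.
Proof.
move=> H a b a0 ab.
suff small n : `|f b - f a| <= (b - a) * (K a - K b) / n.+1%:R.
  have c : (fun n => (b - a) * (K a - K b) / n.+1%:R) @ \oo --> (0 : R).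
    rewrite -[X in _ --> X](mulr0 ((b - a) * (K a - K b))); apply: cvgM; first exact: cvg_cst.
    exact: cvg_harmonic.
  have : `|f b - f a| <= 0.
    rewrite -(cvg_lim (@Rhausdorff R) c); apply: limr_ge; last by apply: nearW => n; exact: small.
    by apply/cvg_ex; exists 0.
  by rewrite normr_le0 subr_eq0 eq_sym => /eqP.
pose h := (b - a) / n.+1%:R.
have h0 : 0 <= h by rewrite divr_ge0 ?subr_ge0.
have step (i : nat) : `|f (a + i%:R * h) - f a| <= h * (K a - K (a + i%:R * h)).
  elim: i => [|i IH]; first by rewrite mul0r addr0 !subrr normr0 mulr0.
  have i0 : 0 < a + i%:R * h by rewrite ltr_pwDl// mulr_ge0.
  have := H (a + i%:R * h) (a + i.+1%:R * h) i0.
  have -> : a + i.+1%:R * h = a + i%:R * h + h by rewrite -natr1; ring.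
  rewrite lerDl => /(_ h0).
  have -> : a + i%:R * h + h - (a + i%:R * h) = h by ring.
  move: (a + i%:R * h) IH => x IH Hx.
  have -> : f (x + h) - f a = (f (x + h) - f x) + (f x - f a) by ring.
  apply: (le_trans (ler_normD _ _)).
  have -> : h * (K a - K (x + h)) = h * (K x - K (x + h)) + h * (K a - K x) by ring.
  exact: lerD.
have := step n.+1.
have hn : n.+1%:R * h = b - a by rewrite /h mulrC divfK// pnatr_eq0.
have -> : a + n.+1%:R * h = b by rewrite hn; ring.
by rewrite /h mulrAC.
Qed.

(** * Integration against kappa *)

Section kappa.
Context {R : realType} (Phi : R -> R) (kappa : {measure set R -> \bar R}).
Hypothesis Phi_gt0 : forall s, 0 < s -> 0 < Phi s.
Hypothesis Phi_double : forall s, 0 < s -> Phi (2 * s) <= 2 * Phi s.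
Hypothesis Phi_derivable : forall s, 0 < s -> derivable Phi s 1.
Hypothesis kappaE : forall s : R, 0 < s ->
  (\int[kappa]_(x in `[0%R, +oo[) (expR (- (s * x)))%:E)%E = ((derive1 Phi s) / Phi s)%:E.

Let D : set R := `]0, +oo[%classic.
Let mD : measurable D. Proof. exact: measurable_itv. Qed.
Let K (s : R) : R := derive1 Phi s / Phi s.
Let psi (s : R) : R := ln (Phi s).

Let mexp c (E : set R) : measurable_fun E (fun x : R => (expR (- (c * x)))%:E).
Proof.
apply: measurable_funTS; apply/measurable_EFinP.
by apply: measurableT_comp; [exact: measurable_expR|apply: measurableT_comp].
Qed.

Lemma log_derivative_nincr s t : 0 < s -> s <= t -> K t <= K s.
Proof.
move=> s0 st; rewrite -lee_fin -!kappaE//; last exact: lt_le_trans st.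
apply: ge0_le_integral => //.
by move=> x; rewrite /= in_itv/= andbT => x0; rewrite lee_fin ler_expR lerN2 ler_wpM2r.
Qed.

Lemma psi_MVT a b : 0 < a -> a < b -> exists2 c, a < c < b & psi b - psi a = K c * (b - a).
Proof.
move=> a0 ab.
have dpsi (x : R) : 0 < x -> is_derive x 1 psi (K x).
  move=> x0.
  have dP : is_derive x 1 Phi (derive1 Phi x).
    by rewrite derive1E; apply: DeriveDef => //; exact: Phi_derivable.
  have dD := @is_derive1_comp R (@ln R) Phi x _ _ (is_derive1_ln (Phi_gt0 x0)) dP.
  by apply: (is_derive_eq dD); rewrite mulrC.
have [x xab| |c cab E] := @MVT R psi K a b ab.
- by apply: dpsi; move: xab; rewrite in_itv/= => /andP[ax _]; exact: lt_trans ax.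
- apply: continuous_in_subspaceT => x; rewrite inE/= in_itv/= => /andP[ax _].
  apply: differentiable_continuous; apply/derivable1_diffP.
  by case: (dpsi x (lt_le_trans a0 ax)).
- by exists c => //; move: cab; rewrite in_itv.
Qed.

Lemma psi_bounds a b : 0 < a -> a <= b ->
  (b - a) * K b <= psi b - psi a <= (b - a) * K a.
Proof.
move=> a0; rewrite le_eqVlt => /predU1P[<-|ab]; first by rewrite !subrr !mul0r lexx.
have [c /andP[ac cb] ->] := psi_MVT a0 ab.
rewrite [K c * _]mulrC !ler_pM2l ?subr_gt0//.
by rewrite (log_derivative_nincr (lt_trans a0 ac) (ltW cb)) (log_derivative_nincr a0 (ltW ac)).
Qed.

(** K is nonincreasing, so s K(2s) is at most the increment of ln Phi over [s, 2s], which doubling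
    bounds by ln 2. This gives K decay of order 1/s. *)
Lemma log_derivative_double s : 0 < s -> s * K (2 * s) <= ln 2.
Proof.
move=> s0; have s2 : s <= 2 * s by lra.
have /andP[+ _] := psi_bounds s0 s2.
have -> : 2 * s - s = s by ring.
move=> /le_trans; apply.
rewrite lerBlDr /psi -lnM ?posrE ?Phi_gt0//.
have P2 : 0 < Phi (2 * s) by apply: Phi_gt0; rewrite mulr_gt0.
by rewrite ler_ln ?posrE ?(mulr_gt0 _ (Phi_gt0 s0))//; exact: Phi_double.
Qed.

Lemma log_derivative_ge0 s : 0 < s -> 0 <= K s.
Proof.
move=> s0; rewrite -lee_fin -kappaE//.
by apply: integral_ge0 => x _; rewrite lee_fin expR_ge0.
Qed.

Lemma cvg_log_derivative : (fun n => K n.+1%:R) @ \oo --> (0 : R).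
Proof.
have ub : (fun n : nat => 2 * ln 2 * n.+1%:R^-1) @ \oo --> (0 : R).
  rewrite -[X in _ --> X](mulr0 (2 * ln 2)); apply: cvgM; first exact: cvg_cst.
  exact: cvg_harmonic.
apply: (squeeze_cvgr _ (cvg_cst 0) ub); near=> n.
have n0 : 0 < n.+1%:R :> R by rewrite ltr0n.
rewrite log_derivative_ge0//= ler_pdivlMr//.
have n2 : 0 < n.+1%:R / 2 :> R by rewrite divr_gt0.
have := log_derivative_double n2.
have -> : 2 * (n.+1%:R / 2) = n.+1%:R :> R by field.
lra.
Unshelve. all: by end_near. Qed.

(** The mass at 0 is at most the Laplace transform at every point, and that tends to 0. This
    reconciles [0, +oo[ in the hypothesis with ]0, +oo[ in the conclusion. *)
Lemma kappa_set0 : kappa [set 0] = 0%E.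
Proof.
have m0 : measurable [set (0 : R)] by exact: measurable_set1.
apply/eqP; rewrite eq_le measure_ge0 andbT.
have H n : (kappa [set 0%R] <= (K n.+1%:R)%:E)%E.
  rewrite -kappaE// -[leLHS]mul1e -integral_cst//.
  apply: (@le_trans _ _ (\int[kappa]_(x in [set 0%R]) (expR (- (n.+1%:R * x)))%:E)%E).
    apply: ge0_le_integral => //.
    by move=> x /= ->; rewrite mulr0 oppr0 expR0.
  apply: ge0_subset_integral => //.
  by move=> x /= ->; rewrite in_itv/= lexx.
have c : (K n.+1%:R)%:E @[n --> \oo] --> 0%E.
  by apply: cvg_EFin; [exact: nearW|exact: cvg_log_derivative].
rewrite -(cvg_lim _ c)//; apply: lime_ge; last exact: nearW.
by apply/cvg_ex; exists 0%E.
Qed.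

Lemma integral_exp_kappa s : 0 < s ->
  (\int[kappa]_(x in D) (expR (- (s * x)))%:E = (K s)%:E)%E.
Proof.
move=> s0; rewrite -kappaE//.
have -> : `[0, +oo[%classic = [set 0] `|` D :> set R.
  apply/seteqP; split=> x; rewrite /D /= !in_itv/= !andbT.
    by rewrite le_eqVlt => /predU1P[->|]; [left|right].
  by case=> [->|/ltW].
rewrite ge0_integral_setU//; last first.
  by apply/disj_setPS => x [/= ->]; rewrite /D /= in_itv/= ltxx.
rewrite [X in (X + _)%E](_ : _ = 0%E) ?add0e//.
apply: null_set_integral; [exact: measurable_set1|exact: mexp|exact: kappa_set0].
Qed.

Lemma integrable_exp_kappa s : 0 < s ->
  kappa.-integrable D (EFin \o (fun x => expR (- (s * x)))).
Proof.
move=> s0; apply/integrableP; split; first exact: mexp.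
rewrite (_ : (\int[kappa]_(x in D) _ = (K s)%:E)%E) ?ltry//.
rewrite -integral_exp_kappa//; apply: eq_integral => x _.
by rewrite gee0_abs// lee_fin expR_ge0.
Qed.

Lemma Rintegral_exp_kappa s : 0 < s -> \int[kappa]_(x in D) expR (- (s * x)) = K s.
Proof. by move=> s0; rewrite /Rintegral integral_exp_kappa. Qed.

Let iZ c s : 0 < s -> kappa.-integrable D (EFin \o (fun x => c * expR (- (s * x)))).
Proof.
move=> s0; have -> : EFin \o (fun x => c * expR (- (s * x))) =
    (fun x => (c%:E * (expR (- (s * x)))%:E)%E) by apply/funext.
by apply: integrableZl => //; exact: integrable_exp_kappa.
Qed.

Lemma integrable_qexp a b : 0 < a -> 0 < b -> kappa.-integrable D (EFin \o qexp a b).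
Proof.
have main a' b' : 0 < a' -> a' <= b' -> kappa.-integrable D (EFin \o qexp a' b').
  move=> a0 ab; apply: (le_integrable mD _ _ (iZ (b' - a') a0)).
    by apply/measurable_EFinP; exact: measurable_qexp.
  move=> x; rewrite /D /= in_itv/= andbT => x0; rewrite lee_fin.
  have /andP[lo hi] := qexp_bounds x0 a0 ab.
  have b0 : 0 <= b' - a' by rewrite subr_ge0.
  have q0 : 0 <= qexp a' b' x by apply: le_trans lo; rewrite mulr_ge0 ?expR_ge0.
  by rewrite (ger0_norm q0) ger0_norm// mulr_ge0 ?expR_ge0.
move=> a0 b0; have [ab|/ltW ba] := leP a b; first exact: main.
have -> : EFin \o qexp a b = (fun x => (-1)%:E * (qexp b a x)%:E)%E.
  by apply/funext => x /=; rewrite -EFinM /qexp; congr EFin; ring.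
by apply: integrableZl => //; exact: main.
Qed.

(** Frullani's formula. The increments of both sides over [a, b] lie between (b - a) K b and (b - a)
    K a, so their difference is constant, and it vanishes at s = 1. *)
Lemma Rintegral_qexp s : 0 < s -> \int[kappa]_(x in D) qexp 1 s x = psi s - psi 1.
Proof.
move=> s0.
pose f t := psi t - \int[kappa]_(x in D) qexp 1 t x.
have fb a b : 0 < a -> a <= b -> `|f b - f a| <= (b - a) * (K a - K b).
  move=> a0 ab; have b0 := lt_le_trans a0 ab.
  have E : \int[kappa]_(x in D) qexp 1 b x =
      \int[kappa]_(x in D) qexp 1 a x + \int[kappa]_(x in D) qexp a b x.
    rewrite -RintegralD//; try by apply: integrable_qexp.
    by apply: eq_Rintegral => x _; rewrite -qexpD.
  have lo : (b - a) * K b <= \int[kappa]_(x in D) qexp a b x.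
    rewrite -Rintegral_exp_kappa// -RintegralZl//; last exact: integrable_exp_kappa.
    apply: le_Rintegral => //; [exact: iZ|exact: integrable_qexp|].
    move=> x; rewrite /D /= in_itv/= andbT => x0.
    by case/andP: (qexp_bounds x0 a0 ab).
  have hi : \int[kappa]_(x in D) qexp a b x <= (b - a) * K a.
    rewrite -Rintegral_exp_kappa// -RintegralZl//; last exact: integrable_exp_kappa.
    apply: le_Rintegral => //; [exact: integrable_qexp|exact: iZ|].
    move=> x; rewrite /D /= in_itv/= andbT => x0.
    by case/andP: (qexp_bounds x0 a0 ab).
  have /andP[lo' hi'] := psi_bounds a0 ab.
  by rewrite /f E ler_norml mulrBr; apply/andP; split; lra.
have f1 : f s = f 1.
  have [s1|/ltW s1] := leP s 1.
    exact: (eq_of_increment_bound fb).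
  by apply/esym; exact: (eq_of_increment_bound fb).
have q0 : \int[kappa]_(x in D) qexp 1 1 x = 0.
  rewrite (_ : \int[kappa]_(x in D) _ = \int[kappa]_(x in D) (cst 0 x)).
    by rewrite Rintegral_cst// mul0r.
  by apply: eq_Rintegral => x _; rewrite /qexp subrr mul0r.
by move: f1; rewrite /f q0; lra.
Qed.

Let integrable_kint12 w : 0 < w <= 1 -> kappa.-integrable D (EFin \o kint (1 + w)).
Proof.
move=> w01; have /andP[w0 _] := w01.
apply: (le_integrable mD _ _ (iZ w ltr01)).
  by apply/measurable_EFinP; exact: measurable_kint.
move=> x; rewrite /D /= in_itv/= andbT => x0; rewrite lee_fin.
have /andP[lo hi] := kint_bounds x0 w01.
rewrite ler0_norm// ger0_norm ?mulr_ge0 ?expR_ge0 ?(ltW w0)// mul1r; lra.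
Qed.

Let integrable_kint_succ r : 0 < r ->
  kappa.-integrable D (EFin \o kint r) -> kappa.-integrable D (EFin \o kint (r + 1)).
Proof.
move=> r0 ik.
have iq := integrable_qexp ltr01 r0.
apply: eq_integrable (integrableD mD ik iq) => // x; rewrite inE /D /= in_itv/= andbT => x0.
by rewrite kint_succ.
Qed.

(** The pointwise bounds settle ]1, 2]; [kint_succ] then reaches ]0, 1] backwards and r > 2
    forwards, the correction being an integrable Frullani term. *)
Lemma integrable_kint r : 0 < r -> kappa.-integrable D (EFin \o kint r).
Proof.
move=> r0; have [n] := ubnP (Num.truncn r).
elim: n r r0 => // n IH r r0 rn.
have [r1|r1] := leP r 1.
  have iq := integrable_qexp ltr01 r0.
  have w01 : 0 < r <= 1 by rewrite r0.
  apply: eq_integrable (integrableB mD (integrable_kint12 w01) iq) => // x.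
  rewrite inE /D /= in_itv/= andbT => x0.
  have E : kint (1 + r) x = kint r x + qexp 1 r x by rewrite addrC kint_succ.
  by rewrite /= E -EFinB addrK.
have [r2|r2] := leP r 2.
  have -> : r = 1 + (r - 1) by ring.
  by apply: integrable_kint12; rewrite subr_gt0 r1/=; lra.
rewrite -(subrK 1 r); apply: integrable_kint_succ; first by lra.
apply: IH; first by lra.
by move: rn; rewrite !truncn_lt_nat; lra.
Qed.

Lemma Rintegral_kint_succ r : 0 < r ->
  \int[kappa]_(x in D) kint (r + 1) x = \int[kappa]_(x in D) kint r x + (psi r - psi 1).
Proof.
move=> r0; rewrite -Rintegral_qexp// -RintegralD//.
- by apply: eq_Rintegral => x; rewrite inE /D /= in_itv/= andbT => x0; rewrite kint_succ.
- exact: integrable_kint.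
- exact: integrable_qexp.
Qed.

(** Integrates [kint_tail]: its remainder lies between -w e^(-(n+1)x) and 0, hence the error w K(n +
    1). *)
Lemma Rintegral_kint_tail n w : 0 < n -> 0 < w <= 1 -> 
  - (w * K (n + 1)) <= \int[kappa]_(x in D) kint (n + 1 + w) x
    - \int[kappa]_(x in D) kint (n + 1) x - w * (psi (n + 1) - psi 1) <= 0.
Proof.
move=> n0 w01; have /andP[w0 w1] := w01.
have n10 : 0 < n + 1 by lra.
have iq := integrable_qexp ltr01 n10.
have iwq : kappa.-integrable D (EFin \o (fun x => w * qexp 1 (n + 1) x)).
  have -> : EFin \o (fun x => w * qexp 1 (n + 1) x) = (fun x => (w%:E * (qexp 1 (n + 1) x)%:E)%E).
    by apply/funext.
  exact: integrableZl.
pose g x := expR (- (n * x)) * kint (1 + w) x.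
have gb x : 0 < x -> - w * expR (- ((n + 1) * x)) <= g x <= 0.
  move=> x0; have /andP[lo hi] := kint_bounds x0 w01.
  have e0 := expR_gt0 (- (n * x)).
  have -> : - w * expR (- ((n + 1) * x)) = expR (- (n * x)) * (- (w * expR (- x))).
    have -> : - ((n + 1) * x) = - (n * x) + - x by ring.
    by rewrite expRD; ring.
  by rewrite ler_pM2l// lo/= /g pmulr_rle0.
have ig : kappa.-integrable D (EFin \o g).
  apply: (le_integrable mD _ _ (iZ w n10)).
    apply/measurable_EFinP; apply: measurable_funM.
      by apply/measurable_EFinP; exact: mexp.
    by exact: measurable_kint.
  move=> x; rewrite /D /= in_itv/= andbT => x0; rewrite lee_fin.
  have /andP[lo hi] := gb x x0.
  rewrite ler0_norm// ger0_norm ?mulr_ge0 ?expR_ge0 ?(ltW w0)//; lra.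
have E : \int[kappa]_(x in D) kint (n + 1 + w) x = \int[kappa]_(x in D) kint (n + 1) x
    + w * (psi (n + 1) - psi 1) + \int[kappa]_(x in D) g x.
  rewrite -Rintegral_qexp// -RintegralZl// -RintegralD//; last exact: integrable_kint.
  rewrite -RintegralD//.
    by apply: eq_Rintegral => x; rewrite inE /D /= in_itv/= andbT => x0; rewrite kint_tail.
  exact: (integrableD mD (integrable_kint n10) iwq).
have lo : - w * K (n + 1) <= \int[kappa]_(x in D) g x.
  rewrite -Rintegral_exp_kappa// -RintegralZl//; last exact: integrable_exp_kappa.
  apply: le_Rintegral => //; first exact: iZ.
  by move=> x; rewrite /D /= in_itv/= andbT => x0; case/andP: (gb x x0).
have hi : \int[kappa]_(x in D) g x <= 0.
  have <- : \int[kappa]_(x in D) (cst 0 x) = 0 by rewrite Rintegral_cst// mul0r.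
  apply: le_Rintegral => //.
    exact: integrable0.
  by move=> x; rewrite /D /= in_itv/= andbT => x0; case/andP: (gb x x0).
by rewrite E; apply/andP; split; lra.
Qed.
End kappa.

(** * Uniqueness and conclusion *)

Section Webster_uniqueness.
Context {R : realType} (m gm kk Phi K : R -> R).
Hypothesis m_gt0 : forall r, 1 <= r -> 0 < m r.
Hypothesis gm_gt0 : forall r, 1 <= r -> 0 < gm r.
Hypothesis Phi_gt0 : forall r, 0 < r -> 0 < Phi r.
Hypothesis Phi_ndecr : forall r s, 0 < r -> r <= s -> Phi r <= Phi s.
Hypothesis m_rec : forall r, 0 < r -> r * m r = Phi r * m (r + 1).
Hypothesis gm_rec : forall r, 0 < r -> gm (r + 1) = r * gm r.
Hypothesis m_log_convex : forall a b t, 1 <= a -> 1 <= b -> 0 < t < 1 ->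
  m ((1 - t) * a + t * b) <= m a `^ (1 - t) * m b `^ t.
Hypothesis gm_log_convex : forall a b t, 1 <= a -> 1 <= b -> 0 < t < 1 ->
  gm ((1 - t) * a + t * b) <= gm a `^ (1 - t) * gm b `^ t.
Hypothesis kk_rec : forall r, 0 < r -> kk (r + 1) = kk r + (ln (Phi r) - ln (Phi 1)).
Hypothesis kk_tail : forall n w, 0 < n -> 0 < w <= 1 ->
  - (w * K (n + 1)) <= kk (n + 1 + w) - kk (n + 1) - w * (ln (Phi (n + 1)) - ln (Phi 1)) <= 0.
Hypothesis K_ge0 : forall s, 0 < s -> 0 <= K s.
Hypothesis K_cvg : (fun n => K n.+1%:R) @ \oo --> (0 : R).
Hypothesis m1 : m 1 = 1.
Hypothesis gm1 : gm 1 = 1.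
Hypothesis kk1 : kk 1 = 0.

Let F r := Phi 1 `^ (r - 1) * expR (kk r).

Let P1 : 0 < Phi 1. Proof. exact: Phi_gt0. Qed.

Let F_gt0 r : 0 < F r.
Proof. by rewrite mulr_gt0 ?powR_gt0 ?expR_gt0. Qed.

Let F_rec r : 0 < r -> F (r + 1) = Phi r * F r.
Proof.
move=> r0; have Pr := Phi_gt0 r0.
rewrite /F kk_rec// expRD expRD expRN !lnK ?posrE//.
have -> : Phi 1 `^ (r + 1 - 1) = Phi 1 `^ (r - 1) * Phi 1.
  have -> : r + 1 - 1 = (r - 1) + 1 by ring.
  by rewrite powRD ?powRr1 ?(ltW P1)// (gt_eqF P1) implybT.
by field; rewrite gt_eqF.
Qed.

Let ratio_step (c r : R) : 0 < r ->
  m r * F r = c * gm r <-> m (r + 1) * F (r + 1) = c * gm (r + 1).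
Proof.
move=> r0; rewrite F_rec// gm_rec//.
have -> : m (r + 1) * (Phi r * F r) = r * (m r * F r).
  by rewrite [RHS]mulrA m_rec//; ring.
have -> : c * (r * gm r) = r * (c * gm r) by ring.
by split => [->//|]; apply: mulfI; rewrite gt_eqF.
Qed.

Let ratio_int n : m n.+1%:R * F n.+1%:R = gm n.+1%:R.
Proof.
elim: n => [|n IH]; first by rewrite /F m1 gm1 kk1 expR0 subrr powRr0 !mulr1.
have n0 : 0 < n.+1%:R :> R by rewrite ltr0n.
by rewrite -[n.+2%:R]natr1 -[RHS]mul1r; apply/(ratio_step 1 n0).1; rewrite mul1r.
Qed.

Let ratio_shift (c w : R) n : 0 < w -> m (1 + w) * F (1 + w) = c * gm (1 + w) ->
  m (n%:R + 1 + w) * F (n%:R + 1 + w) = c * gm (n%:R + 1 + w).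
Proof.
move=> w0 H; elim: n => [|n IH]; first by rewrite add0r.
have -> : n.+1%:R + 1 + w = n%:R + 1 + w + 1 by rewrite -natr1; ring.
apply/(ratio_step c _).1 => //.
by rewrite ltr_wpDl// addr_ge0.
Qed.

(** Here n = k + 1, so that the interpolation bounds apply from 1 on. In the upper bound Phi(n + 1)
    cancels exactly; in the lower one Phi(n + 1)/Phi(n) remains and is at least 1 by monotonicity.
    The exponent w is then removed using w <= 1. *)
Let ratio_bounds (c w : R) (k : nat) : 0 < w <= 1 -> 0 < c ->
  m (1 + w) * F (1 + w) = c * gm (1 + w) ->
  (1 - (k.+1%:R + 1)^-1) * (1 - K (k.+1%:R + 1)) <= c <= 1 + k.+1%:R^-1.
Proof.
move=> w01 c0 H; set n : R := k.+1%:R; have /andP[w0 w1] := w01.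
have n1 : 1 <= n by rewrite ler1n.
have n0 : 0 < n by rewrite ltr0n.
have n11 : 1 <= n + 1 by lra.
have n10 : 0 < n + 1 by lra.
have n1w : 1 <= n + 1 + w by lra.
have Pn := Phi_gt0 n0; have Pn1 := Phi_gt0 n10.
have E := ratio_shift k.+1 w0 H; rewrite -/n in E.
(* Here the recursion factor is r / Phi(r), read off from [m_rec]. *)
have /andP[mlo mhi] := @log_convex_ratio R m (fun r => r / Phi r) m_gt0
  (fun r (r1 : 1 <= r) => divr_gt0 (lt_le_trans ltr01 r1) (Phi_gt0 (lt_le_trans ltr01 r1)))
  (fun r (r1 : 1 <= r) => ltac:(have r0 := lt_le_trans ltr01 r1;
     by rewrite mulrAC m_rec// mulrAC mulfV ?mul1r// gt_eqF// Phi_gt0))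
  m_log_convex n w n1 w01.
have /andP[glo ghi] := @log_convex_ratio R gm idfun gm_gt0
  (fun r (r1 : 1 <= r) => lt_le_trans ltr01 r1)
  (fun r (r1 : 1 <= r) => gm_rec (lt_le_trans ltr01 r1)) gm_log_convex n w n1 w01.
rewrite /= in mlo mhi glo ghi.
have E1 : m (n + 1) * F (n + 1) = gm (n + 1).
  by have := ratio_int k.+1; rewrite -[k.+2%:R]natr1.
have /andP[tlo thi] := kk_tail n0 w01.
set tau := (X in - _ <= X) in tlo thi.
have FE : F (n + 1 + w) = F (n + 1) * Phi (n + 1) `^ w * expR tau.
  have -> : Phi (n + 1) `^ w = expR (w * ln (Phi (n + 1))) by rewrite /powR gt_eqF.
  rewrite /F /powR gt_eqF// -!expRD; congr expR; rewrite /tau; ring.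
have G0 : 0 < gm (n + 1) by exact: gm_gt0.
have Gw0 : 0 < gm (n + 1 + w) by exact: gm_gt0.
have nw0 : 0 < n `^ w by exact: powR_gt0.
have n1w0 : 0 < (n + 1) `^ w by exact: powR_gt0.
have Pw0 : 0 < Phi (n + 1) `^ w by exact: powR_gt0.
have et0 : 0 < expR tau by exact: expR_gt0.
have Fn0 : 0 < F (n + 1) by exact: F_gt0.
have quot (x y : R) : 0 < x -> 0 < y -> (x / y) `^ w * y `^ w = x `^ w.
  move=> x0 y0; rewrite -powRM ?divr_ge0 ?(ltW x0) ?(ltW y0)//.
  by rewrite divfK// gt_eqF.
apply/andP; split.
  have lo : gm (n + 1) * n `^ w * expR tau <= c * gm (n + 1 + w).
    rewrite -E FE.
    apply: (@le_trans _ _ (m (n + 1) * (n / Phi n) `^ w * (F (n + 1) * Phi (n + 1) `^ w * expR tau))).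
      have -> : m (n + 1) * (n / Phi n) `^ w * (F (n + 1) * Phi (n + 1) `^ w * expR tau) =
          gm (n + 1) * ((n / Phi n) `^ w * Phi (n + 1) `^ w) * expR tau.
        by rewrite -E1; ring.
      rewrite ler_pM2r// ler_pM2l// -(quot n (Phi n))// ler_pM2l ?powR_gt0 ?divr_gt0//.
      by rewrite ge0_ler_powR ?nnegrE ?(ltW w0) ?(ltW Pn) ?(ltW Pn1)// Phi_ndecr// lerDl.
    by rewrite (ler_pM2r (mulr_gt0 (mulr_gt0 Fn0 Pw0) et0)).
  have {lo} lo : n `^ w * expR tau <= c * (n + 1) `^ w.
    have : gm (n + 1) * n `^ w * expR tau <= c * (gm (n + 1) * (n + 1) `^ w).
      by apply: (le_trans lo); rewrite ler_pM2l.
    have -> : c * (gm (n + 1) * (n + 1) `^ w) = gm (n + 1) * (c * (n + 1) `^ w) by ring.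
    by rewrite -mulrA ler_pM2l.
  apply: (@le_trans _ _ ((n / (n + 1)) `^ w * expR tau)); last first.
    by rewrite -(ler_pM2r n1w0) mulrAC quot.
  have K0 := K_ge0 n10.
  have q0 : 0 < n / (n + 1) by rewrite divr_gt0.
  have q1 : n / (n + 1) <= 1 by rewrite ler_pdivrMr//; lra.
  have -> : 1 - (n + 1)^-1 = n / (n + 1) by field; rewrite gt_eqF.
  have h1 : n / (n + 1) <= (n / (n + 1)) `^ w by rewrite ger1_powR// q0.
  have h2 : 1 - K (n + 1) <= expR tau.
    apply: le_trans (expR_ge1Dx tau); rewrite lerD2l; apply: le_trans tlo.
    by rewrite lerN2 ler_piMl.
  apply: (@le_trans _ _ (n / (n + 1) * expR tau)); first by rewrite ler_pM2l.
  by rewrite ler_pM2r.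
have hi : c * (gm (n + 1) * n `^ w) <= gm (n + 1) * (n + 1) `^ w.
  apply: (@le_trans _ _ (c * gm (n + 1 + w))); first by rewrite ler_pM2l.
  rewrite -E FE.
  apply: (@le_trans _ _ (m (n + 1) * ((n + 1) / Phi (n + 1)) `^ w *
      (F (n + 1) * Phi (n + 1) `^ w * expR tau))).
    by rewrite (ler_pM2r (mulr_gt0 (mulr_gt0 Fn0 Pw0) et0)).
  have -> : m (n + 1) * ((n + 1) / Phi (n + 1)) `^ w * (F (n + 1) * Phi (n + 1) `^ w * expR tau) =
    gm (n + 1) * (((n + 1) / Phi (n + 1)) `^ w * Phi (n + 1) `^ w) * expR tau.
    by rewrite -E1; ring.
  rewrite quot// ler_piMr// ?mulr_ge0 ?(ltW G0) ?(ltW n1w0)//.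
  by rewrite -[leRHS]expR0 ler_expR.
have {}hi : c * n `^ w <= (n + 1) `^ w.
  by rewrite -(ler_pM2l G0); move: hi; rewrite mulrCA.
have h : c <= ((n + 1) / n) `^ w by rewrite -(ler_pM2r nw0) quot.
apply: (le_trans h).
have -> : 1 + n^-1 = (n + 1) / n by field; rewrite gt_eqF.
by rewrite ler1_powR// ler_pdivlMr//; lra.
Qed.

(** Periodicity keeps c the same for every k, while both bounds tend to 1. *)
Let ratio12 (w : R) : 0 < w <= 1 -> m (1 + w) * F (1 + w) = gm (1 + w).
Proof.
move=> w01; have /andP[w0 _] := w01.
have w1 : 1 <= 1 + w by lra.
have gw := gm_gt0 w1; have mw := m_gt0 w1.
pose c := m (1 + w) * F (1 + w) / gm (1 + w).
have c0 : 0 < c by rewrite divr_gt0// mulr_gt0.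
have H : m (1 + w) * F (1 + w) = c * gm (1 + w) by rewrite /c divfK// gt_eqF.
have B k := ratio_bounds k w01 c0 H.
rewrite H; suff -> : c = 1 by rewrite mul1r.
have ch : (fun k : nat => (k.+1%:R : R)^-1) @ \oo --> (0 : R) by exact: cvg_harmonic.
have up : (fun k : nat => 1 + (k.+1%:R : R)^-1) @ \oo --> (1 : R).
  by rewrite -[X in _ --> X]addr0; apply: cvgD => //; exact: cvg_cst.
have dn : (fun k : nat => (1 - (k.+1%:R + 1 : R)^-1) * (1 - K (k.+1%:R + 1))) @ \oo --> (1 : R).
  rewrite -[X in _ --> X]mulr1; apply: cvgM; rewrite -[X in _ --> X]subr0; apply: cvgB;
    try exact: cvg_cst.
    have := ch; rewrite -cvg_shiftS; apply: cvg_trans; apply: near_eq_cvg.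
    by near=> k; rewrite natr1.
  have := K_cvg; rewrite -cvg_shiftS; apply: cvg_trans; apply: near_eq_cvg.
  by near=> k; rewrite natr1.
apply/eqP; rewrite eq_le; apply/andP; split.
  rewrite -(cvg_lim (@Rhausdorff R) up); apply: limr_ge; first by apply/cvg_ex; exists 1.
  by apply: nearW => k; case/andP: (B k).
rewrite -(cvg_lim (@Rhausdorff R) dn); apply: limr_le; first by apply/cvg_ex; exists 1.
by apply: nearW => k; case/andP: (B k).
Unshelve. all: by end_near. Qed.

Lemma Webster_uniqueness r : 0 < r ->
  m r = gm r * Phi 1 `^ (1 - r) * expR (- kk r).
Proof.
move=> r0.
suff H : m r * F r = gm r.
  rewrite -H /F; have -> : 1 - r = - (r - 1) by ring.
  rewrite powRN expRN; field.
  by rewrite !gt_eqF ?powR_gt0 ?expR_gt0.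
have [n] := ubnP (Num.truncn r).
elim: n r r0 => // n IH r r0 rn.
have [r1|r1] := leP r 1.
  rewrite -[RHS]mul1r; apply/(ratio_step 1 r0).2; rewrite mul1r addrC.
  by apply: ratio12; rewrite r0.
have [r2|r2] := leP r 2.
  have -> : r = 1 + (r - 1) by ring.
  by apply: ratio12; rewrite subr_gt0 r1/=; lra.
have r10 : 0 < r - 1 by lra.
rewrite -(subrK 1 r) -[RHS]mul1r; apply/(ratio_step 1 r10).1; rewrite mul1r.
apply: IH => //.
by move: rn; rewrite !truncn_lt_nat; lra.
Qed.
End Webster_uniqueness.

(** A zero integral would make f vanish almost everywhere, so the null set would be the whole space,
    of mass 1. *)
Lemma Rintegral_gt0 (d : measure_display) (T : measurableType d) (R : realType)
    (P : probability T R) (f : T -> R) :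
  P.-integrable [set: T] (EFin \o f) -> (forall w, 0 <= f w) ->
  {ae P, forall w, 0 < f w} -> 0 < \int[P]_w f w.
Proof.
move=> intf f0 fae.
have If := integrable_fin_num measurableT intf.
rewrite /Rintegral fine_gt0// -ge0_fin_numE ?If ?andbT; last first.
  by apply: integral_ge0 => w _; rewrite lee_fin.
rewrite lt0e integral_ge0 ?andbT; last by move=> w _; rewrite lee_fin.
apply/eqP => I0.
have /(ae_eq_integral_abs P measurableT (measurable_int _ intf)) H :
    (\int[P]_w `|(EFin \o f) w| = 0)%E.
  by rewrite -I0; apply: eq_integral => w _; rewrite gee0_abs// lee_fin.
have : {ae P, forall w : T, False}.
  by apply: filterS2 H fae => w /(_ Logic.I) /= [->]; rewrite ltxx.
move=> [N [mN PN sub]].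
have NT : N = [set: T] by apply/seteqP; split=> // w _; exact: sub.
have := probability_setT P; rewrite -NT PN => /eqP.
by rewrite eq_sym onee_eq0.
Qed.

Lemma kint1 (R : realType) (x : R) : kint 1 x = 0.
Proof. by rewrite /kint subrr !mul0r oppr0 expR0 subrr addr0 mul0r. Qed.

Unset Implicit Arguments.
Set Strict Implicit.

Theorem theorem3p2 (d : measure_display) (T : measurableType d) (R : realType)
    (P : probability T R) (xi : R -> T -> \bar R) (Phi : R -> R)
    (kappa : {measure set R -> \bar R}) :
  subordinator P xi ->
  (forall l s : R, 0 <= l -> 0 < s ->
     (\int[P]_w expeR (- (s%:E * xi l w)))%E = (expR (- (l * Phi s)))%:E) ->
  (exists s : R, 0 < s /\ Phi s != 0) ->
  kappa `]-oo, 0%R[%classic = 0%E ->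
  (forall s : R, 0 < s ->
     (\int[kappa]_(x in `[0%R, +oo[) (expR (- (s * x)))%:E)%E
       = ((derive1 Phi s) / Phi s)%:E) ->
  forall r : R, 0 < r ->
    (\int[P]_w poweR (expfun xi w) (r - 1))%E
    = (Gammaf r * (Phi 1 `^ (1 - r))%:E
       * expeR (- \int[kappa]_(x in `]0%R, +oo[) (kint r x)%:E))%E.
Proof.
move=> xiP laplace Phi_neq0 _ kappaE r r0.
(* Time 1 alone determines Phi, through E[Y^s] = e^(-Phi(s)). *)
pose Y w := expN (xi 1 w).
have xi1 w : (0 <= xi 1%R w)%E by exact: (subordinator_ge0 xiP).
have mY : measurable_fun [set: T] Y.
  by apply: measurableT_comp; [exact: measurable_expN|exact: (subordinator_meas xiP)].
have Y01 w : 0 <= Y w <= 1 by rewrite expN_ge0 expN_le1.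
have laplaceY s : 0 < s -> (\int[P]_w (Y w `^ s)%:E)%E = (expR (- Phi s))%:E.
  move=> s0; rewrite -[Phi s]mul1r -laplace//.
  by apply: eq_integral => w _; rewrite expN_powR.
have Phi_gt0 : forall s, 0 < s -> 0 < Phi s 
  by move=> s; apply: (Laplace_exponent_gt0 mY Y01 laplaceY Phi_neq0).
have Phi_ndecr : forall s t, 0 < s -> s <= t -> Phi s <= Phi t.
  by move=> s; apply: (Laplace_exponent_ndecr mY Y01 laplaceY).
have Phi_double : forall s, 0 < s -> Phi (2 * s) <= 2 * Phi s.
  by move=> s; apply: (Laplace_exponent_double mY laplaceY).
have Phi_derivable : forall s, 0 < s -> derivable Phi s 1.
  by move=> s; apply: (Laplace_exponent_derivable mY Y01 laplaceY).
pose I w := fine (expfun xi w).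
have I_ge0 w : 0 <= I w by apply/fine_ge0/ltW/(expfun_gt0 xiP).
have I_gt0 : {ae P, forall w, 0 < I w} by exact: (fine_expfun_gt0 xiP laplace Phi_gt0).
have iI s : 0 < s -> P.-integrable [set: T] (EFin \o (fun w => I w `^ (s - 1))).
  by move=> s0; have [] := expfun_recursion xiP laplace Phi_gt0 s0.
pose m s := \int[P]_w (I w `^ (s - 1)).
have mE s : 0 < s -> (\int[P]_w (I w `^ (s - 1))%:E)%E = (m s)%:E.
  by move=> s0; rewrite /m /Rintegral fineK//; apply: integrable_fin_num (iI s s0).
have m_gt0 s : 1 <= s -> 0 < m s.
  move=> s1; apply: Rintegral_gt0.
  - by apply: iI; exact: lt_le_trans s1.
  - by move=> w; exact: powR_ge0.
  - by apply: filterS I_gt0 => w; exact: powR_gt0.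
have m_rec s : 0 < s -> s * m s = Phi s * m (s + 1).
  move=> s0; have [_] := expfun_recursion xiP laplace Phi_gt0 s0.
  have -> : (\int[P]_w (fine (expfun xi w) `^ s)%:E)%E = (m (s + 1))%:E.
    by rewrite -mE ?addr_gt0// addrK.
  by rewrite mE// -!EFinM => -[].
have m_log_convex a b t : 1 <= a -> 1 <= b -> 0 < t < 1 ->
    m ((1 - t) * a + t * b) <= m a `^ (1 - t) * m b `^ t.
  move=> a1 b1 t01; have /andP[t0 t1] := t01.
  have a0 : 0 < a by lra.
  have b0 : 0 < b by lra.
  have [_] := @Rintegral_log_convex _ _ _ P setT measurableT (fun w => I w `^ (a - 1))
    (fun w => I w `^ (b - 1)) t t01 (fun w _ => powR_ge0 _ _) (fun w _ => powR_ge0 _ _)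
    (iI a a0) (iI b b0) (m_gt0 a a1) (m_gt0 b b1).
  apply: le_trans; rewrite le_eqVlt; apply/orP; left; apply/eqP.
  apply: eq_Rintegral => w _; rewrite -!powRrM.
  have -> : (1 - t) * a + t * b - 1 = (a - 1) * (1 - t) + (b - 1) * t by ring.
  have p1 : 0 <= (a - 1) * (1 - t) by rewrite mulr_ge0 ?subr_ge0// ltW.
  have p2 : 0 <= (b - 1) * t by rewrite mulr_ge0 ?subr_ge0// ltW.
  (* Exponents of I, which may be 0 on a null set, add freely only when their sum is nonzero; a zero
     sum of two nonnegative exponents forces both to be 0. *)
  have [e0|e0] := eqVneq ((a - 1) * (1 - t) + (b - 1) * t) 0.
    have e1 : (a - 1) * (1 - t) = 0 by lra.
    have e2 : (b - 1) * t = 0 by lra.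
    by rewrite e1 e2 addr0 !powRr0 mulr1.
  by rewrite powRD// (negbTE e0).
pose kk s := \int[kappa]_(x in `]0, +oo[) kint s x.
have main : m r = fine (Gammaf r) * Phi 1 `^ (1 - r) * expR (- kk r).
  apply: (@Webster_uniqueness R m (fun s => fine (Gammaf s)) kk Phi
    (fun s => derive1 Phi s / Phi s)) => //.
  - move=> s s1; apply: fine_gt0; rewrite Gamma_gt0//=.
    by apply: Gamma_lty; exact: lt_le_trans s1.
  - by move=> s s0; rewrite Gamma_recursion// fineM// ge0_fin_numE ?Gamma_ge0 ?Gamma_lty.
  - exact: Gamma_log_convex.
  - exact: (Rintegral_kint_succ Phi_gt0 Phi_double Phi_derivable kappaE).
  - exact: (Rintegral_kint_tail Phi_gt0 Phi_double Phi_derivable kappaE).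
  - exact: (log_derivative_ge0 kappaE).
  - exact: (cvg_log_derivative Phi_gt0 Phi_double Phi_derivable kappaE).
  - rewrite /m subrr (_ : \int[P]_w _ = \int[P]_w (cst 1 w)); last first.
      by apply: eq_Rintegral => w _; rewrite powRr0.
    rewrite Rintegral_cst// mul1r -[RHS]/(fine 1%E); congr fine.
    exact: probability_setT.
  - by rewrite Gamma1.
  - rewrite /kk (_ : \int[kappa]_(x in _) _ = \int[kappa]_(x in `]0, +oo[) (cst 0 x)).
      by rewrite Rintegral_cst// mul0r.
    by apply: eq_Rintegral => x _; rewrite kint1.
rewrite (poweR_expfun xiP laplace Phi_gt0) mE// main !EFinM fineK; last first.
  by rewrite ge0_fin_numE ?Gamma_ge0 ?Gamma_lty.
congr (_ * _)%E.
(* Finiteness of the integral turns the extended exponential into the real one. *)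
have /fineK <- : (\int[kappa]_(x in `]0%R, +oo[) (kint r x)%:E)%E \is a fin_num.
  apply: integrable_fin_num => //.
  exact: (integrable_kint Phi_gt0 Phi_double Phi_derivable kappaE r0).
by [].
Qed.
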